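(* Fix integers $q\ge2$, $k\ge2$ and $0<\eta<1/2$. Suppose $\gamma_{q,k}:=(k-1)-\frac1{q-1}>0$. Then there is a constant $C_{\eta,q,k}$ such that for all sufficiently large $n$, $$W_{\eta,q,k}(n)\le C_{\eta,q,k}\,\frac{n}{\log n}.$$
   Context: Random atomic CSP. Variables $x_1,\dots,x_n$ take values in $[q]=\{0,\dots,q-1\}$. An atomic constraint is a pair $(S,a)$ with $S\subseteq[n]$, $|S|=k$, and $a\in[q]^S$; it forbids (covers) exactly the assignments $x\in[q]^n$ with $x_S=a$. Let $\mathcal C_{n,q,k}$ be the set of all atomic constraints, $N_{n,q,k}=|\mathcal C_{n,q,k}|=q^k\binom nk$. Each constraint is selected independently with probability $p$; $\mu_p$ is the resulting product measure on $2^{\mathcal C_{n,q,k}}$. $\mathrm{Cover}_{n,q,k}$ is the (monotone) event that the sets of assignments forbidden by the selected constraints cover all of $[q]^n$, i.e. the CSP is unsatisfiable. For $0<\alpha<1$, $p_\alpha=p_\alpha(n)=\inf\{p\in[0,1]:\mu_p(\mathrm{Cover}_{n,q,k})\ge\alpha\}$, and $W_{\eta,q,k}(n)=N_{n,q,k}(p_{1-\eta}-p_\eta)$. *)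

(* Defs.v *)
From HB Require Import structures.
From mathcomp Require Import all_boot all_order all_algebra.
From mathcomp Require Import all_classical all_reals all_analysis.
Set Implicit Arguments.
Unset Strict Implicit.
Unset Printing Implicit Defensive.
Import Order.TTheory GRing.Theory Num.Theory.
Local Open Scope ring_scope.

(* Variables are indexed by 'I_n and the alphabet [q] is 'I_q. *)
Definition assignment (n q : nat) : finType := {ffun 'I_n -> 'I_q}.

Definition scope (n k : nat) : finType := {S : {set 'I_n} | #|S| == k}.

(* A pair (S, a) with S a k-subset of the variables and a : S -> [q]. *)
Definition constraint (n q k : nat) : finType :=
  {S : scope n k & {ffun {i : 'I_n | i \in val S} -> 'I_q}}.

Definition forbids (n q k : nat) (c : constraint n q k) (x : assignment n q) :
    bool :=
  [forall i : {i : 'I_n | i \in val (tag c)}, x (val i) == tagged c i].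

(* The event, as a set of sets of selected constraints. *)
Definition Cover (n q k : nat) : {set {set constraint n q k}} :=
  [set F : {set constraint n q k} |
    [forall x : assignment n q, exists c in F, forbids c x]].

(* Each element of T is selected independently with probability p. *)
Definition mu (R : realType) (T : finType) (p : R) (A : {set {set T}}) : R :=
  \sum_(F in A) \prod_(c : T) (if c \in F then p else 1 - p).

Definition Nconstraints (n q k : nat) : nat := #|constraint n q k|.

Lemma NconstraintsE (n q k : nat) :
  Nconstraints n q k = (q ^ k * 'C(n, k))%N.
Proof.
rewrite /Nconstraints card_tagged sumnE big_map big_enum /=.
rewrite (eq_bigr (fun=> (q ^ k)%N)) => [|S _].
  by rewrite sum_nat_const card_sig -cardsE card_draws card_ord mulnC.
by rewrite card_ffun card_sig card_ord (eqP (valP S)).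
Qed.

Definition threshold (R : realType) (n q k : nat) (alpha : R) : R :=
  inf [set p : R | 0 <= p <= 1 /\ alpha <= mu p (Cover n q k)]%classic.

Definition window (R : realType) (n q k : nat) (eta : R) : R :=
  (Nconstraints n q k)%:R * (threshold n q k (1 - eta) - threshold n q k eta).

Definition gammaqk (R : realType) (q k : nat) : R :=
  (k%:R - 1) - 1 / (q%:R - 1).

(* Main.v *)
Require Import Defs.
From HB Require Import structures.
From mathcomp Require Import all_boot all_order all_algebra.
From mathcomp Require Import all_classical all_reals all_analysis.
From mathcomp Require Import fintype finset perm zify ring lra.
Set Implicit Arguments.
Unset Strict Implicit.
Unset Printing Implicit Defensive.

(* Let f be the indicator of unsatisfiability on the p-biased cube of sets of
   constraints, and h_c the indicator that c is pivotal. By Russo's formula it is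
   enough to find, in the interval between the two thresholds, a density p at which
   p * sum_c E h_c is at least of order log n.

   The variance of f is at most d^-1 p sum_c E h_c + rho^-d p sum_c <h_c, T_rho h_c>,
   so with d of order log n it suffices that <h_c, T_rho h_c> is smaller than E h_c by
   a power of n. A fourth moment inequality for the noise operator on the p-biased
   cube reduces this to h_c being global: its discrete derivative along a set J of
   O(log n) constraints has small second moment. If J and c have distinct representing
   variables, then falsifying one literal at each of them satisfies J and c, and it
   only has to be shown that forbidding O(log n) literals on distinct variables
   creates unsatisfiability with probability at most n^-eps. By symmetry this
   probability depends only on the number of literals; if one more forbidden literal
   mattered, then many literals would be forced, and all the constraints made of
   forced literals would be pivotal, so that a derivative in p would be large. By
   Hall's theorem the remaining sets J contain, possibly with c, more constraints
   than variables, and there are too few such sets to matter.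

   The density p comes from a single application of the mean value theorem to the
   expectation of (1 + n X) f + average_j f_j, where X counts with small weights the
   sets with more constraints than variables, and f_j is the indicator that the
   instance with j forbidden literals is unsatisfiable. *)

(** * Hall's theorem *)

Section Hall.
Variables (I X : finType).
Implicit Types (J K A B : {set I}) (V : I -> {set X}).

Definition nbhd V J : {set X} := \bigcup_(i in J) V i.

Lemma nbhdU1 V i J : nbhd V (i |: J) = V i :|: nbhd V J.
Proof. by rewrite /nbhd bigcup_setU big_set1. Qed.

Lemma eq_nbhd V V' J : {in J, V =1 V'} -> nbhd V J = nbhd V' J.
Proof. by move=> e; apply: eq_bigr => i /e. Qed.

(* Rado's proof: as long as some [V i] has two elements, one of them can be
   deleted without violating Hall's condition. *)
Lemma hall_marriage V J (x0 : X) : (forall K, K \subset J -> #|K| <= #|nbhd V K|) ->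
  exists2 l : I -> X, {in J, forall i, l i \in V i} & {in J &, injective l}.
Proof.
have [m] := ubnP (\sum_(i in J) #|V i|); elim: m V => // m IHm V ltm hallV.
have V_gt0 i : i \in J -> 0 < #|V i|.
  move=> iJ; have := hallV [set i]; rewrite sub1set => /(_ iJ).
  by rewrite cards1 /nbhd big_set1.
(* When every [V i] is a singleton, Hall's condition on pairs makes the forced choice injective; the
   default [x0] is never reached on [J]. *)
have [/existsP[i0 /andP[iJ V2]]|/existsPn V1] := boolP [exists i in J, 1 < #|V i|]; last first.
  have VE i : i \in J -> exists x, V i = [set x].
    move=> iJ; apply/cards1P; rewrite eqn_leq V_gt0 // andbT.
    by have := V1 i; rewrite iJ /= -leqNgt.
  exists (fun i => odflt x0 [pick x in V i]) => [i iJ|i j iJ jJ].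
    by have [x ->] := VE i iJ; case: pickP => [y|/(_ x)]; rewrite ?inE ?eqxx.
  have [x Ex] := VE i iJ; have [y Ey] := VE j jJ.
  rewrite Ex Ey; case: pickP => [x'|/(_ x)]; rewrite ?inE ?eqxx // => /eqP->.
  case: pickP => [y'|/(_ y)]; rewrite ?inE ?eqxx // => /eqP-> /= exy.
  apply/eqP; apply: contraT => ij; have := hallV [set i; j].
  rewrite subUset !sub1set iJ jJ cards2 ij /nbhd bigcup_setU !big_set1 Ex Ey exy setUid cards1.
  by move=> /(_ isT).
pose del x i := if i == i0 then V i0 :\ x else V i.
have delE x A : i0 \notin A -> nbhd (del x) A = nbhd V A.
  move=> iA; apply: eq_nbhd => i iA'; rewrite /del; case: eqP => // ei.
  by rewrite -ei iA' in iA.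
have del_sub x i : del x i \subset V i.
  by rewrite /del; case: eqP => [->|]; rewrite ?subD1set.
have step x : x \in V i0 -> (forall K, K \subset J -> #|K| <= #|nbhd (del x) K|) ->
    exists2 l : I -> X, {in J, forall i, l i \in V i} & {in J &, injective l}.
  move=> xV /IHm[].
    rewrite -ltnS; apply: leq_trans ltm; rewrite ltnS.
    rewrite (bigD1 i0) //= [X in _ < X](bigD1 i0) //= /del eqxx.
    rewrite (cardsD1 x (V i0)) xV add1n addSn ltnS leq_add2l.
    by apply: leq_sum => i /andP[_ /negbTE->].
  move=> l l1 l2; exists l => // i /l1; exact: (subsetP (del_sub x i)).
(* A violation created by deleting [x] must involve [i0]; taking [i0] out of it gives [A]. *)
have fail x : ~ (forall K, K \subset J -> #|K| <= #|nbhd (del x) K|) ->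
    exists A, [/\ i0 \notin A, A \subset J & #|(V i0 :\ x) :|: nbhd V A| <= #|A|].
  move=> nh; have /existsP[K] : [exists K : {set I}, (K \subset J) && (#|nbhd (del x) K| < #|K|)].
    apply: contraT => /existsPn nK; case: nh => K sK; have := nK K.
    by rewrite sK /= -leqNgt.
  move=> /andP[sK ltK]; have iK : i0 \in K.
    by apply: contraT => iK; move: ltK; rewrite delE // ltnNge hallV.
  exists (K :\ i0); rewrite !inE eqxx; split=> //; first exact: subset_trans (subD1set _ _) sK.
  move: ltK; rewrite -{1}(setD1K iK) nbhdU1 (cardsD1 i0 K) iK add1n ltnS.
  by rewrite delE ?inE ?eqxx // /del eqxx.
have [x [y [xV yV xy]]] : exists x y, [/\ x \in V i0, y \in V i0 & x != y].
  by move/card_gt1P: V2 => [x [y [? ? ?]]]; exists x, y.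
have alt z : z \in V i0 -> (exists2 l : I -> X, {in J, forall i, l i \in V i} & {in J &, injective l}) \/
    exists A, [/\ i0 \notin A, A \subset J & #|(V i0 :\ z) :|: nbhd V A| <= #|A|].
  move=> zV; have [/forallP hz|/forallPn nz] :=
      boolP [forall K : {set I}, (K \subset J) ==> (#|K| <= #|nbhd (del z) K|)].
    by left; apply: (step z) => // K sK; have := hz K; rewrite sK.
  right; apply: (fail z) => hz; case: nz => K; rewrite negb_imply => /andP[sK].
  by rewrite hz.
have [//|[A [iA sA cA]]] := alt x xV; have [//|[B [iB sB cB]]] := alt y yV.
set P := V i0 :\ x :|: nbhd V A in cA; set Q := V i0 :\ y :|: nbhd V B in cB.
(* Two failed deletions contradict submodularity: as [x] and [y] differ, [P :|: Q] contains all of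
   [V i0], so |A| + |B| >= |P| + |Q| >= |A :|: B| + 1 + |A :&: B|. *)
have sU : nbhd V (i0 |: (A :|: B)) \subset P :|: Q.
  rewrite nbhdU1 /nbhd bigcup_setU -/(nbhd V A) -/(nbhd V B); apply/subsetP => z.
  rewrite !inE => /orP[zV|/orP[->|->]]; rewrite ?orbT //.
  by rewrite zV !andbT; case: (eqVneq z x) => [->|] //=; rewrite xy !orbT.
have sI : nbhd V (A :&: B) \subset P :&: Q.
  apply/subsetP => z /bigcupP[i]; rewrite !inE => /andP[iA' iB'] zi.
  have -> : z \in nbhd V A by apply/bigcupP; exists i.
  have -> : z \in nbhd V B by apply/bigcupP; exists i.
  by rewrite !orbT.
have hU := hallV (i0 |: (A :|: B)); have hI := hallV (A :&: B).
have cU : #|i0 |: (A :|: B)| = #|A :|: B|.+1 by rewrite cardsU1 inE negb_or iA iB.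
have := cardsUI P Q; have := cardsUI A B.
have := subset_leq_card sU; have := subset_leq_card sI.
have := hI (subset_trans (subsetIl _ _) sA).
have : i0 |: (A :|: B) \subset J by rewrite !subUset sub1set iJ sA sB.
by move=> /hU; rewrite cU; move: cA cB; clear; lia.
Qed.

End Hall.

Import Order.TTheory GRing.Theory Num.Theory.
Local Open Scope ring_scope.

(** * Analysis on the biased cube *)

Section Subsets.
Variable T : finType.
Implicit Types A B J F : {set T}.

Lemma setU1_ind (P : {set T} -> Prop) :
  P set0 -> (forall x A, x \notin A -> P A -> P (x |: A)) -> forall A, P A.
Proof.
move=> P0 PU A; have [m] := ubnP #|A|; elim: m A => // m IHm A.
have [-> // | [x xA]] := set_0Vmem A.
rewrite ltnS -(setD1K xA) cardsU1 !inE eqxx => leA.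
by apply: PU; rewrite ?inE ?eqxx //; apply: IHm.
Qed.

Lemma sum_subsetU1 (V : nmodType) (x : T) A (G : {set T} -> V) : x \notin A ->
  \sum_(F : {set T} | F \subset x |: A) G F =
  \sum_(F : {set T} | F \subset A) (G (x |: F) + G F).
Proof.
move=> xA; rewrite (bigID (fun F : {set T} => x \in F)) /= big_split /=; congr (_ + _).
  rewrite (reindex_onto (fun F => x |: F) (fun F => F :\ x)) /=; last first.
    by move=> F /andP[_ xF]; rewrite setD1K.
  apply: eq_bigl => F; rewrite setU11 andbT.
  apply/idP/idP.
    move=> /andP[sF /eqP eF]; have xF : x \notin F by rewrite -eF !inE eqxx.
    by apply/subsetP=> i iF; move/subsetP/(_ i): sF; rewrite !inE iF orbT;
      move=> /(_ isT) /orP[/eqP ei|//]; rewrite -ei iF in xF.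
  move=> sF; rewrite setUS //=; apply/eqP/setU1K.
  by apply: contra xA; apply/subsetP.
apply: eq_bigl => F; apply/idP/idP.
  move=> /andP[sF xF]; apply/subsetP=> i iF; move/subsetP/(_ i iF): sF.
  by rewrite !inE => /orP[/eqP ei|//]; rewrite -ei iF in xF.
move=> sF; rewrite (subset_trans sF (subsetUr _ _)) /=.
by apply: contra xA; apply/subsetP.
Qed.

End Subsets.

Section Cube.
Variables (R : realFieldType) (T : finType).
Implicit Types (p r : R) (A B J F G S U : {set T}) (f g : {set T} -> R).

(** The set [A] of live coordinates is a parameter so that identities on the cube can be proved by
    adding one coordinate at a time. *)
Definition weight p A F : R := \prod_(c in A) (if c \in F then p else 1 - p).
Definition expect p A f : R := \sum_(F : {set T} | F \subset A) weight p A F * f F.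
(** The iterated discrete derivative; it does not depend on [F :&: J]. The mean of [diff S f], times
    the square root of (p(1-p))^|S|, is the biased Fourier coefficient at [S]; the unnormalised mean
    avoids square roots. *)
Definition diff J f F : R :=
  \sum_(U : {set T} | U \subset J) (-1) ^+ #|J :\: U| * f (F :\: J :|: U).

Definition avg p (x : T) f F : R := p * f (x |: F) + (1 - p) * f F.
Definition dif (x : T) f F : R := f (x |: F) - f F.

Lemma expect_eq p A f g : (forall F, F \subset A -> f F = g F) ->
  expect p A f = expect p A g.
Proof. by move=> fg; apply: eq_bigr => F sF; rewrite fg. Qed.

Lemma expect_lin p A (a b : R) f g :
  expect p A (fun F => a * f F + b * g F) = a * expect p A f + b * expect p A g.
Proof.
by rewrite /expect !mulr_sumr -big_split; apply: eq_bigr => F _ /=; ring.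
Qed.

Lemma expectD p A f g :
  expect p A (fun F => f F + g F) = expect p A f + expect p A g.
Proof. by rewrite /expect -big_split; apply: eq_bigr => F _ /=; ring. Qed.

Lemma expectZ p A a f : expect p A (fun F => a * f F) = a * expect p A f.
Proof. by rewrite /expect mulr_sumr; apply: eq_bigr => F _ /=; ring. Qed.

Lemma expect_sum p A (I : Type) (s : seq I) (P : pred I) (f : I -> {set T} -> R) :
  expect p A (fun F => \sum_(i <- s | P i) f i F) = \sum_(i <- s | P i) expect p A (f i).
Proof.
rewrite /expect exchange_big /=; apply: eq_bigr => F _; rewrite mulr_sumr.
by [].
Qed.

Lemma weight_ge0 p A F : 0 <= p <= 1 -> 0 <= weight p A F.
Proof.
move=> p01; apply: prodr_ge0 => c _; case: ifP => _; lra.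
Qed.

Lemma expect_le p A f g : 0 <= p <= 1 -> (forall F, F \subset A -> f F <= g F) ->
  expect p A f <= expect p A g.
Proof.
by move=> p01 fg; apply: ler_sum => F sF; rewrite ler_wpM2l ?weight_ge0 ?fg.
Qed.

Lemma expect0 p f : expect p set0 f = f set0.
Proof.
rewrite /expect (big_pred1 set0) => [|F]; last by rewrite subset0.
by rewrite /weight big_set0 mul1r.
Qed.

Lemma diff0 f F : diff set0 f F = f F.
Proof.
rewrite /diff (big_pred1 set0) => [|U]; last by rewrite subset0.
by rewrite !setD0 cards0 expr0 mul1r setU0.
Qed.

Lemma notin_subset (x : T) A F : x \notin A -> F \subset A -> x \notin F.
Proof. by move=> xA /subsetP sF; apply: contra xA => /sF. Qed.

Lemma weightU1 p x A F : x \notin A -> x \notin F ->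
  weight p (x |: A) F = (1 - p) * weight p A F.
Proof. by move=> xA xF; rewrite /weight big_setU1 //= (negbTE xF). Qed.

Lemma weightU1_in p x A F : x \notin A ->
  weight p (x |: A) (x |: F) = p * weight p A F.
Proof.
move=> xA; rewrite /weight big_setU1 //= setU11; congr (_ * _).
apply: eq_bigr => c cA; rewrite !inE; case: eqP => // ecx.
by rewrite ecx (negbTE xA) in cA.
Qed.

Lemma expectU1 p x A f : x \notin A -> expect p (x |: A) f = expect p A (avg p x f).
Proof.
move=> xA; rewrite /expect sum_subsetU1 //; apply: eq_bigr => F sF.
rewrite weightU1_in // weightU1 ?(notin_subset xA) // /avg; ring.
Qed.

Lemma diff_eq A J f g F : J \subset A -> F \subset A ->
  (forall G, G \subset A -> f G = g G) -> diff J f F = diff J g F.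
Proof.
move=> sJ sF fg; apply: eq_bigr => U sU; rewrite fg //.
by rewrite subUset (subset_trans (subsetDl _ _)) // (subset_trans sU).
Qed.

Lemma diff_lin J (a b : R) f g F :
  diff J (fun F => a * f F + b * g F) F = a * diff J f F + b * diff J g F.
Proof. by rewrite /diff !mulr_sumr -big_split; apply: eq_bigr => U _ /=; ring. Qed.

Lemma diff_addpt J x f F : x \notin J ->
  diff J f (x |: F) = diff J (fun G => f (x |: G)) F.
Proof.
move=> xJ; apply: eq_bigr => U sU; congr (_ * f _).
rewrite setDUl (_ : [set x] :\: J = [set x]) ?setUA //.
by apply/setDidPl; rewrite disjoints1.
Qed.

Lemma diff_avg p x J f F : x \notin J ->
  avg p x (diff J f) F = diff J (avg p x f) F.
Proof. by move=> xJ; rewrite {1}/avg diff_addpt // -diff_lin. Qed.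

Lemma dif_diff x J f F : x \notin J ->
  dif x (diff J f) F = diff J (dif x f) F.
Proof.
move=> xJ; rewrite {1}/dif diff_addpt //.
rewrite -[X in X - _]mul1r -mulN1r -diff_lin.
by apply: eq_bigr => U _; congr (_ * _); rewrite /dif; ring.
Qed.

Lemma diffU1 x J f F : x \notin J -> diff (x |: J) f F = diff J (dif x f) (F :\ x).
Proof.
move=> xJ; rewrite /diff sum_subsetU1 //; apply: eq_bigr => U sU.
have xU := notin_subset xJ sU.
have -> : (x |: J) :\: (x |: U) = J :\: U.
  apply/setP=> i; rewrite !inE; case: (eqVneq i x) => [->|] //=.
  by rewrite (negbTE xJ) andbF.
have -> : (x |: J) :\: U = x |: (J :\: U).
  by apply/setP=> i; rewrite !inE; case: (eqVneq i x) => [->|] //=; rewrite xU.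
rewrite cardsU1 !inE (negbTE xJ) andbF /= exprS.
have -> : F :\: (x |: J) :|: (x |: U) = x |: (F :\ x :\: J :|: U).
  by apply/setP=> i; rewrite !inE; case: (eqVneq i x) => [->|] //=; rewrite ?andbF ?andbT.
have -> : F :\: (x |: J) :|: U = F :\ x :\: J :|: U.
  by apply/setP=> i; rewrite !inE negb_or; case: (eqVneq i x) => [->|] //=; rewrite ?andbF ?andbT.
rewrite /dif; ring.
Qed.

Lemma setD1_notin x F : x \notin F -> F :\ x = F.
Proof. by move=> xF; apply/setDidPl; rewrite disjoint_sym disjoints1. Qed.

Lemma expect_diffU1 p x A J f : x \notin A -> J \subset A ->
  expect p (x |: A) (diff (x |: J) f) = expect p A (diff J (dif x f)).
Proof.
move=> xA sJ; rewrite expectU1 //; apply: expect_eq => F sF.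
have xF := notin_subset xA sF; have xJ := notin_subset xA sJ.
by rewrite /avg !diffU1 // setU1K // setD1_notin //; ring.
Qed.

Lemma expect_diff p x A J f : x \notin A -> J \subset A ->
  expect p (x |: A) (diff J f) = expect p A (diff J (avg p x f)).
Proof.
move=> xA sJ; rewrite expectU1 //; apply: expect_eq => F sF.
by rewrite diff_avg ?(notin_subset xA).
Qed.

Lemma expect_sqr_diffU1 p x A J f : x \notin A -> J \subset A ->
  expect p (x |: A) (fun F => diff (x |: J) f F ^+ 2) =
  expect p A (fun F => diff J (dif x f) F ^+ 2).
Proof.
move=> xA sJ; rewrite expectU1 //; apply: expect_eq => F sF.
have xF := notin_subset xA sF; have xJ := notin_subset xA sJ.
by rewrite /avg !diffU1 // setU1K // setD1_notin //; ring.
Qed.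

Lemma expect_sqr_diff p x A J f : x \notin A -> J \subset A ->
  expect p (x |: A) (fun F => diff J f F ^+ 2) =
  expect p A (fun F => diff J (avg p x f) F ^+ 2) +
  p * (1 - p) * expect p A (fun F => diff J (dif x f) F ^+ 2).
Proof.
move=> xA sJ; rewrite expectU1 // -expectZ -expectD; apply: expect_eq => F sF.
have xJ := notin_subset xA sJ.
rewrite -dif_diff // -diff_avg // /avg /dif; ring.
Qed.

(** On one coordinate, the mean of a product is the product of the averages plus p(1-p) times the
    product of the derivatives; a new coordinate thus splits the sum according to whether [S]
    contains it. *)
Lemma parseval p A f g :
  expect p A (fun F => f F * g F) =
  \sum_(S : {set T} | S \subset A)
    (p * (1 - p)) ^+ #|S| * (expect p A (diff S f) * expect p A (diff S g)).
Proof.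
elim/setU1_ind: A f g => [|x A xA IH] f g.
  rewrite (big_pred1 set0) => [|F]; last by rewrite subset0.
  by rewrite cards0 expr0 mul1r !expect0 !diff0.
rewrite sum_subsetU1 // expectU1 //.
transitivity (expect p A (fun F => avg p x f F * avg p x g F) +
  p * (1 - p) * expect p A (fun F => dif x f F * dif x g F)).
  rewrite -expectZ -expectD; apply: expect_eq => F sF; rewrite /avg /dif; ring.
rewrite !IH mulr_sumr -big_split; apply: eq_bigr => S sS /=.
rewrite !expect_diffU1 // !expect_diff // cardsU1 (notin_subset xA) //=.
rewrite exprD expr1; ring.
Qed.

(** Differentiation along [J] retains exactly the Fourier coefficients at the sets containing
    [J]. *)
Lemma parseval_diff p A J f : J \subset A ->
  (p * (1 - p)) ^+ #|J| * expect p A (fun F => diff J f F ^+ 2) =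
  \sum_(S : {set T} | S \subset A)
    (J \subset S)%:R * ((p * (1 - p)) ^+ #|S| * expect p A (diff S f) ^+ 2).
Proof.
elim/setU1_ind: A J f => [|x A xA IH] J f.
  rewrite subset0 => /eqP->; rewrite (big_pred1 set0) => [|F]; last by rewrite subset0.
  by rewrite cards0 expr0 !mul1r !expect0 !diff0 sub0set mul1r.
move=> sJ; rewrite sum_subsetU1 //.
have [xJ|xJ] := boolP (x \in J).
  have sJA : J :\ x \subset A.
    apply/subsetP=> i; rewrite !inE => /andP[ix iJ].
    by move/subsetP/(_ i iJ): sJ; rewrite !inE (negbTE ix).
  have xJ' : x \notin J :\ x by rewrite !inE eqxx.
  rewrite -{1 2}(setD1K xJ) cardsU1 xJ' expect_sqr_diffU1 // exprD -mulrA IH // mulr_sumr.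
  apply: eq_bigr => S sS; have xS := notin_subset xA sS.
  rewrite expect_diffU1 // cardsU1 xS.
  have -> : (J \subset S) = false.
    by apply/negbTE; apply: contra xS => /subsetP; apply.
  have -> : (J \subset x |: S) = (J :\ x \subset S) by rewrite subDset.
  by rewrite exprD expr1 mul0r addr0; case: (_ \subset _); rewrite ?(mul0r, mul1r, mulr0) //; ring.
have sJA : J \subset A.
  apply/subsetP=> i iJ; move/subsetP/(_ i iJ): sJ; rewrite !inE.
  by case: eqP => // eix; rewrite -eix iJ in xJ.
rewrite expect_sqr_diff // mulrDr mulrCA !IH // mulr_sumr -big_split.
apply: eq_bigr => S sS; have xS := notin_subset xA sS.
rewrite /= expect_diffU1 // expect_diff // cardsU1 xS.
have -> : (J \subset x |: S) = (J \subset S).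
  apply/idP/idP => [/subsetP s|s]; last exact: subset_trans s (subsetUr _ _).
  apply/subsetP=> i iJ; move: (s i iJ); rewrite !inE.
  by case: eqP => // eix; rewrite -eix iJ in xJ.
by rewrite exprD expr1; case: (_ \subset _); rewrite ?(mul0r, mul1r, mulr0, addr0) //; ring.
Qed.

(** The noise operator in spectral form; the products of [(c \in F)%:R - p] are the unnormalised
    characters. *)
Definition noise p r A f F : R :=
  \sum_(S : {set T} | S \subset A)
    r ^+ #|S| * expect p A (diff S f) * \prod_(c in S) ((c \in F)%:R - p).

(** With [noiseU1_in]: along a fresh coordinate the average is kept and the derivative is shrunk by
    [r]. This is the shape of the terms in [two_point_ineq]. *)
Lemma noiseU1 p r x A f F : x \notin A -> F \subset A ->
  noise p r (x |: A) f F =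
  noise p r A (avg p x f) F - r * p * noise p r A (dif x f) F.
Proof.
move=> xA sF; rewrite /noise sum_subsetU1 // mulr_sumr -sumrB.
apply: eq_bigr => S sS; have xS := notin_subset xA sS.
rewrite expect_diffU1 // expect_diff // cardsU1 xS big_setU1 //=.
rewrite (negbTE (notin_subset xA sF)) mulr0n exprD; ring.
Qed.

Lemma noiseU1_in p r x A f F : x \notin A -> F \subset A ->
  noise p r (x |: A) f (x |: F) =
  noise p r A (avg p x f) F + r * (1 - p) * noise p r A (dif x f) F.
Proof.
move=> xA sF; rewrite /noise sum_subsetU1 // mulr_sumr -big_split /=.
apply: eq_bigr => S sS; have xS := notin_subset xA sS.
rewrite expect_diffU1 // expect_diff // cardsU1 xS big_setU1 //= setU11.
have -> : \prod_(c in S) ((c \in x |: F)%:R - p) = \prod_(c in S) ((c \in F)%:R - p).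
  apply: eq_bigr => c cS; rewrite !inE; case: eqP => // ecx.
  by rewrite -ecx cS in xS.
rewrite mulr1n exprD; ring.
Qed.

Lemma expect_diff_noise p r A S f : S \subset A ->
  expect p A (diff S (noise p r A f)) = r ^+ #|S| * expect p A (diff S f).
Proof.
elim/setU1_ind: A S f => [|x A xA IH] S f.
  rewrite subset0 => /eqP->; rewrite cards0 expr0 mul1r !expect0 !diff0.
  rewrite /noise (big_pred1 set0) => [|F]; last by rewrite subset0.
  by rewrite cards0 expr0 mul1r big_set0 mulr1 expect0 diff0.
move=> sS; have [xS|xS] := boolP (x \in S).
  have sSA : S :\ x \subset A.
    apply/subsetP=> i; rewrite !inE => /andP[ix iJ].
    by move/subsetP/(_ i iJ): sS; rewrite !inE (negbTE ix).
  have xS' : x \notin S :\ x by rewrite !inE eqxx.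
  rewrite -(setD1K xS) cardsU1 xS' !expect_diffU1 // exprD -mulrA -IH // -expectZ.
  apply: expect_eq => F sF.
  transitivity (diff (S :\ x) (fun G => r * noise p r A (dif x f) G + 0 * 0) F).
    apply: (diff_eq sSA sF) => G sG; rewrite {1}/dif noiseU1_in // noiseU1 //; ring.
  by rewrite (diff_lin _ r 0 _ (fun=> 0)) mul0r addr0 expr1.
have sSA : S \subset A.
  apply/subsetP=> i iJ; move/subsetP/(_ i iJ): sS; rewrite !inE.
  by case: eqP => // eix; rewrite -eix iJ in xS.
rewrite !expect_diff // -IH //; apply: expect_eq => F sF.
apply: (diff_eq sSA sF) => G sG; rewrite {1}/avg noiseU1_in // noiseU1 //; ring.
Qed.

(** The one-coordinate case of the fourth moment inequality, for two functions with averages [a],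
    [c] and derivatives [b], [d]. The cross terms are absorbed by the inequality of arithmetic and
    geometric means. *)
Lemma two_point_ineq (p r a b c d : R) : 0 <= p <= 1 -> 0 <= r <= 1 / 2 ->
  p * ((a + r * (1 - p) * b) ^+ 2 * (c + r * (1 - p) * d) ^+ 2) +
  (1 - p) * ((a - r * p * b) ^+ 2 * (c - r * p * d) ^+ 2) <=
  a ^+ 2 * c ^+ 2 + p * (1 - p) * (a ^+ 2 * d ^+ 2) +
  p * (1 - p) * (b ^+ 2 * c ^+ 2) +
  ((p * (1 - p)) ^+ 2 + 3 * r ^+ 4 * p) * (b ^+ 2 * d ^+ 2).
Proof.
move=> p01 r02; set v := p * (1 - p).
have v0 : 0 <= v by rewrite /v mulr_ge0; lra.
have vp : v <= p by rewrite /v; nra.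
have -> : p * ((a + r * (1 - p) * b) ^+ 2 * (c + r * (1 - p) * d) ^+ 2) +
  (1 - p) * ((a - r * p * b) ^+ 2 * (c - r * p * d) ^+ 2) =
  a ^+ 2 * c ^+ 2 + r ^+ 2 * v * (a ^+ 2 * d ^+ 2 + b ^+ 2 * c ^+ 2 + 4 * (a * d) * (b * c))
  + v * (2 * (r * (a * d)) * (r ^+ 2 * (1 - 2 * p) * (b * d)) +
         2 * (r * (b * c)) * (r ^+ 2 * (1 - 2 * p) * (b * d)))
  + r ^+ 4 * v * (1 - 3 * v) * (b ^+ 2 * d ^+ 2).
  by rewrite /v; ring.
have sq0 (x : R) : 0 <= x ^+ 2 by exact: sqr_ge0.
have amgm (x y : R) : 2 * x * y <= x ^+ 2 + y ^+ 2.
  by have := sq0 (x - y); rewrite sqrrB; lra.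
have q1 : (1 - 2 * p) ^+ 2 <= 1.
  have -> : (1 - 2 * p) ^+ 2 = 1 - 4 * v by rewrite /v; ring.
  lra.
have B1 : 4 * (a * d) * (b * c) <= 2 * (a ^+ 2 * d ^+ 2 + b ^+ 2 * c ^+ 2).
  have := amgm (a * d) (b * c); rewrite !exprMn; lra.
have B2 (x : R) : 2 * (r * x) * (r ^+ 2 * (1 - 2 * p) * (b * d)) <=
    r ^+ 2 * x ^+ 2 + r ^+ 4 * (b ^+ 2 * d ^+ 2).
  apply: le_trans (amgm _ _) _; rewrite exprMn lerD2l.
  have -> : (r ^+ 2 * (1 - 2 * p) * (b * d)) ^+ 2 =
    r ^+ 4 * ((1 - 2 * p) ^+ 2 * (b ^+ 2 * d ^+ 2)) by ring.
  rewrite ler_wpM2l ?exprn_ge0 //; first lra.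
  by rewrite -[leRHS]mul1r ler_wpM2r // mulr_ge0.
have B3 := B2 (b * c); have B4 := B2 (a * d); rewrite !exprMn in B3 B4.
set X := a ^+ 2 * d ^+ 2 in B1 B4 *; set Y := b ^+ 2 * c ^+ 2 in B1 B3 *.
set Z := b ^+ 2 * d ^+ 2 in B3 B4 *.
have X0 : 0 <= X by rewrite mulr_ge0.
have Y0 : 0 <= Y by rewrite mulr_ge0.
have Z0 : 0 <= Z by rewrite mulr_ge0.
have r2 : r ^+ 2 <= 1 / 4 by nra.
have r4 : 0 <= r ^+ 4 by rewrite exprn_ge0; lra.
(* [X + Y] collects 3 r^2 v here and r^2 v in [E2], at most v in total since r <= 1/2. [Z] collects
   2 r^4 v in [E2] and r^4 v in [E3], whence the constant 3. *)
have E1 : r ^+ 2 * v * (X + Y + 4 * (a * d) * (b * c)) <= r ^+ 2 * v * (3 * (X + Y)).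
  by rewrite ler_wpM2l ?mulr_ge0 //; lra.
have E2 : v * (2 * (r * (a * d)) * (r ^+ 2 * (1 - 2 * p) * (b * d)) +
         2 * (r * (b * c)) * (r ^+ 2 * (1 - 2 * p) * (b * d))) <=
   v * (r ^+ 2 * (X + Y) + 2 * r ^+ 4 * Z).
  by rewrite ler_wpM2l //; lra.
have E3 : r ^+ 4 * v * (1 - 3 * v) * Z <= r ^+ 4 * v * Z.
  by rewrite ler_wpM2r // ler_piMr ?mulr_ge0 //; lra.
have E4 : r ^+ 2 * (v * (X + Y)) <= 1 / 4 * (v * (X + Y)).
  by rewrite ler_wpM2r // mulr_ge0 // addr_ge0.
have E5 : r ^+ 4 * (v * Z) <= r ^+ 4 * (p * Z).
  by rewrite ler_wpM2l // ler_wpM2r.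
have E6 : 0 <= v ^+ 2 * Z by rewrite mulr_ge0.
lra.
Qed.

(* The two-function form is what makes the induction on the coordinates close:
   the mixed terms of [two_point_ineq] are again of the same shape. *)
Lemma noise_sqr_mul_le p r A f g : 0 <= p <= 1 -> 0 <= r <= 1 / 2 ->
  expect p A (fun F => noise p r A f F ^+ 2 * noise p r A g F ^+ 2) <=
  \sum_(J : {set T} | J \subset A) (3 * r ^+ 4 * p) ^+ #|J| *
    (expect p A (fun F => diff J f F ^+ 2) * expect p A (fun F => diff J g F ^+ 2)).
Proof.
move=> p01 r02; elim/setU1_ind: A f g => [|x A xA IH] f g.
  rewrite (big_pred1 set0) => [|F]; last by rewrite subset0.
  rewrite cards0 expr0 mul1r !expect0 !diff0 /noise.
  rewrite !(big_pred1 set0) => [|F|F]; try by rewrite subset0.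
  by rewrite cards0 expr0 big_set0 !mul1r !mulr1 !expect0 !diff0.
rewrite expectU1 // sum_subsetU1 //.
set t := 3 * r ^+ 4 * p; set v := p * (1 - p).
have v0 : 0 <= v by rewrite /v mulr_ge0; lra.
have t0 : 0 <= t by rewrite /t !mulr_ge0 ?exprn_ge0; lra.
apply: le_trans (_ : expect p A (fun F => noise p r A (avg p x f) F ^+ 2 * noise p r A (avg p x g) F ^+ 2) +
  v * expect p A (fun F => noise p r A (avg p x f) F ^+ 2 * noise p r A (dif x g) F ^+ 2) +
  v * expect p A (fun F => noise p r A (dif x f) F ^+ 2 * noise p r A (avg p x g) F ^+ 2) +
  (v ^+ 2 + t) * expect p A (fun F => noise p r A (dif x f) F ^+ 2 * noise p r A (dif x g) F ^+ 2) <= _).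
  rewrite -!expectZ -!expectD; apply: expect_le => // F sF.
  by rewrite /avg !noiseU1_in // !noiseU1 //; apply: two_point_ineq.
apply: le_trans (lerD (lerD (lerD (IH _ _) (ler_wpM2l v0 (IH _ _))) (ler_wpM2l v0 (IH _ _)))
   (ler_wpM2l (addr_ge0 (exprn_ge0 2 v0) t0) (IH _ _))) _.
(* Multiplying out [expect_sqr_diff] for [f] and [g] accounts for the four terms up to [v ^+ 2]; the
   sets [x |: J] account for [t]. *)
rewrite !mulr_sumr -!big_split; apply: ler_sum => J sJ /=.
rewrite !expect_sqr_diffU1 // !expect_sqr_diff // cardsU1 (notin_subset xA) //= exprD -/v -/t.
rewrite le_eqVlt; apply/orP; left; apply/eqP; ring.
Qed.

End Cube.

(** * Variance by Fourier levels, and fourth moments after noise *)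

Section CubeFourier.
Variables (R : realFieldType) (T : finType).
Implicit Types (p r : R) (A B J F G S U : {set T}) (f g h : {set T} -> R).

(** For monotone Boolean [f], the indicator that [c] is pivotal. Unlike [dif], it does not depend on
    whether [c] lies in [F]. *)
Definition infl (c : T) f F : R := f (c |: F) - f (F :\ c).

Local Notation Ex p := (expect p [set: T]).

Lemma diff_infl c S f F : c \notin S -> diff S (infl c f) F = diff (c |: S) f F.
Proof.
move=> cS; rewrite diffU1 //; apply: eq_bigr => U sU; congr (_ * _).
rewrite /infl /dif; congr (f _ - f _).
  by apply/setP=> i; rewrite !inE; case: (eqVneq i c).
apply/setP=> i; rewrite !inE; case: (eqVneq i c) => [->|] //=.
by rewrite (negbTE (notin_subset cS sU)) andbF.
Qed.

Lemma diff_infl0 c S f F : c \in S -> diff S (infl c f) F = 0.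
Proof.
move=> cS; rewrite -(setD1K cS) diffU1 ?inE ?eqxx //.
apply: big1 => U sU; set G := _ :|: U.
have cG : c \notin G.
  have cU : c \notin U by apply: notin_subset sU; rewrite !inE eqxx.
  by rewrite !inE (negbTE cU) eqxx andbF.
by rewrite /dif /infl setUA setUid setU1K // (setD1_notin cG) subrr mulr0.
Qed.

(** Double counting of the pairs formed by a set and one of its elements. *)
Lemma sum_setU1_notin (G : {set T} -> R) :
  \sum_c \sum_(S : {set T} | c \notin S) G (c |: S) =
  \sum_(S : {set T}) #|S|%:R * G S.
Proof.
transitivity (\sum_c \sum_(S : {set T} | c \in S) G S).
  apply: eq_bigr => c _.
  rewrite [RHS](reindex_onto (fun S => c |: S) (fun S => S :\ c)) /=; last first.
    by move=> S cS; rewrite setD1K.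
  apply: eq_bigl => S; rewrite setU11 /=; apply/idP/eqP => [|<-]; first exact: setU1K.
  by rewrite !inE eqxx.
rewrite (exchange_big_dep predT) //=; apply: eq_bigr => S _.
by rewrite sumr_const mulr_natl.
Qed.

Lemma expect_noise2 p r r' h :
  Ex p (fun F => h F * noise p r setT (noise p r' setT h) F) =
  \sum_(S : {set T}) (p * (1 - p)) ^+ #|S| * (r * r') ^+ #|S| * Ex p (diff S h) ^+ 2.
Proof.
rewrite parseval; apply: eq_big => [S|S _]; first by rewrite subsetT.
by rewrite !expect_diff_noise ?subsetT // [(r * r') ^+ _]exprMn; ring.
Qed.

Lemma expect_diff0 p A f : expect p A (diff set0 f) = expect p A f.
Proof. by apply: expect_eq => F _; rewrite diff0. Qed.

(** The variance is the Fourier mass off the empty set. A set with |S| >= d is counted at least d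
    times by the total influence; a smaller one keeps a factor of at least rho^d in the noisy
    influences. *)
Lemma variance_le p r r' f d : 0 <= p <= 1 -> 0 < r * r' <= 1 -> (0 < d)%N ->
  Ex p (fun F => f F ^+ 2) - Ex p f ^+ 2 <=
  d%:R^-1 * (p * (1 - p) * \sum_c Ex p (fun F => infl c f F ^+ 2)) +
  (r * r') ^- d * (p * (1 - p) * \sum_c
     Ex p (fun F => infl c f F * noise p r setT (noise p r' setT (infl c f)) F)).
Proof.
move=> p01 /andP[]; set rho := r * r'; set v := p * (1 - p) => rho0 rho1 d0.
have v0 : 0 <= v by rewrite /v mulr_ge0; lra.
pose e S := v ^+ #|S| * Ex p (diff S f) ^+ 2.
have e0 S : 0 <= e S by rewrite mulr_ge0 ?sqr_ge0 ?exprn_ge0.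
have -> : Ex p (fun F => f F ^+ 2) - Ex p f ^+ 2 = \sum_(S : {set T} | S != set0) e S.
  rewrite (@expect_eq _ _ _ _ _ (fun F => f F * f F)) => [|F _]; last by rewrite expr2.
  rewrite parseval (bigD1 set0) ?sub0set //= cards0 expr0 mul1r expect_diff0 -expr2 addrC addrK.
  by apply: eq_big => [S|S _]; rewrite ?subsetT ?expr2.
have inflE c S : c \notin S -> v * (v ^+ #|S| * Ex p (diff S (infl c f)) ^+ 2) = e (c |: S).
  move=> cS; rewrite /e cardsU1 cS add1n mulrA -exprS; congr (_ * _ ^+ 2).
  by apply: expect_eq => F _; apply: diff_infl.
(* Used for [w] constantly 1 and for the powers of [rho]. Terms with [c] in [S] are nonnegative and
   dropped. *)
have bound (w : nat -> R) : (forall m, 0 <= w m) ->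
    \sum_(S : {set T}) #|S|%:R * (w #|S|.-1 * e S) <=
    v * \sum_c \sum_(S : {set T}) v ^+ #|S| * w #|S| * Ex p (diff S (infl c f)) ^+ 2.
  move=> w0; rewrite -sum_setU1_notin mulr_sumr; apply: ler_sum => c _.
  rewrite mulr_sumr [leRHS](bigID (fun S : {set T} => c \notin S)) /= -[leLHS]addr0 lerD //.
    apply: ler_sum => S cS; rewrite -inflE // cardsU1 cS /=.
    by rewrite le_eqVlt; apply/orP; left; apply/eqP; ring.
  apply: sumr_ge0 => S _; apply: mulr_ge0 => //; apply: mulr_ge0; last exact: sqr_ge0.
  by rewrite mulr_ge0 ?exprn_ge0.
have B1 : \sum_(S : {set T}) #|S|%:R * e S <= v * \sum_c Ex p (fun F => infl c f F ^+ 2).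
  have := bound (fun=> 1) (fun=> ler01).
  under eq_bigr do rewrite mul1r; move=> /le_trans; apply.
  rewrite le_eqVlt; apply/orP; left; apply/eqP; congr (_ * _); apply: eq_bigr => c _.
  rewrite (@expect_eq _ _ _ _ _ (fun F => infl c f F * infl c f F)) => [|F _]; last by rewrite expr2.
  rewrite parseval; apply: eq_big => [S|S _]; first by rewrite subsetT.
  by rewrite mulr1 expr2.
have B2 := bound (fun m => rho ^+ m) (fun m => exprn_ge0 m (ltW rho0)).
apply: le_trans (_ : \sum_(S : {set T} | S != set0)
    (d%:R^-1 * (#|S|%:R * e S) + rho ^- d * (#|S|%:R * (rho ^+ #|S|.-1 * e S))) <= _).
  apply: ler_sum => S S0; move: (e S) (e0 S) => x x0.
  rewrite -[leLHS]mul1r !mulrA -mulrDl ler_wpM2r //.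
  have S1 : (0 < #|S|)%N by rewrite card_gt0.
  have rd0 : 0 < rho ^- d by rewrite invr_gt0 exprn_gt0.
  have [dS|Sd] := leqP d #|S|.
    rewrite -[leLHS]addr0 lerD //; first by rewrite mulrC ler_pdivlMr ?ltr0n // mul1r ler_nat.
    by rewrite !mulr_ge0 ?exprn_ge0 ?ler0n // ltW.
  rewrite -[leLHS]add0r lerD ?mulr_ge0 ?invr_ge0 ?ler0n //.
  have le1 : rho ^+ d <= rho ^+ #|S|.-1.
    by apply: ler_wiXn2l; rewrite ?(ltW rho0) //; apply: leq_trans (leq_pred _) (ltnW Sd).
  rewrite mulrAC -[leLHS]mulr1 ler_pM ?ler1n //.
  by rewrite mulrC ler_pdivlMr ?exprn_gt0 // mul1r.
rewrite big_split -!mulr_sumr /= lerD //.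
  rewrite ler_wpM2l ?invr_ge0 ?ler0n //; apply: le_trans B1.
  by rewrite [leRHS](bigD1 set0) //= cards0 mul0r add0r.
rewrite ler_wpM2l ?invr_ge0 ?exprn_ge0 ?(ltW rho0) //.
apply: le_trans (_ : _ <= \sum_(S : {set T}) #|S|%:R * (rho ^+ #|S|.-1 * e S)) _.
  by rewrite [leRHS](bigD1 set0) //= cards0 mul0r add0r.
apply: le_trans B2 _; rewrite ler_wpM2l //; apply: ler_sum => c _.
by rewrite expect_noise2.
Qed.

Lemma expect1 p A : expect p A (fun=> 1) = 1.
Proof.
elim/setU1_ind: A => [|x A xA IH]; first by rewrite expect0.
by rewrite expectU1 // -[RHS]IH; apply: expect_eq => F _; rewrite /avg; ring.
Qed.

Lemma expect_ge0 p A f : 0 <= p <= 1 -> (forall F, F \subset A -> 0 <= f F) ->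
  0 <= expect p A f.
Proof.
move=> p01 f0; apply: sumr_ge0 => F sF; rewrite mulr_ge0 ?weight_ge0 ?f0 //.
Qed.

(** Deleting [J] from a random set gives its law conditioned on missing [J], an event of probability
    (1-p)^|J|. Likewise [expect_setU] conditions on containing [J]. *)
Lemma expect_setD p A J f : J \subset A ->
  (1 - p) ^+ #|J| * expect p A (fun F => f (F :\: J)) =
  expect p A (fun F => [disjoint F & J]%:R * f F).
Proof.
elim/setU1_ind: A J f => [|x A xA IH] J f.
  rewrite subset0 => /eqP->; rewrite cards0 !expect0 setD0 -setI_eq0 setI0 eqxx.
  by rewrite expr0.
move=> sJ; rewrite !expectU1 //.
have [xJ|xJ] := boolP (x \in J).
  have sJA : J :\ x \subset A.
    apply/subsetP=> i; rewrite !inE => /andP[ix iJ].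
    by move/subsetP/(_ i iJ): sJ; rewrite !inE (negbTE ix).
  rewrite -{1}(setD1K xJ) cardsU1 !inE eqxx /= exprD expr1.
  transitivity ((1 - p) * ((1 - p) ^+ #|J :\ x| * expect p A (fun F => f (F :\: (J :\ x))))).
    rewrite mulrA; congr (_ * _); apply: expect_eq => F sF; rewrite /avg.
    have xF := notin_subset xA sF.
    have -> : (x |: F) :\: J = F :\: (J :\ x).
      apply/setP=> i; rewrite !inE; case: (eqVneq i x) => [->|] //=.
      by rewrite xJ (negbTE xF).
    have -> : F :\: J = F :\: (J :\ x).
      apply/setP=> i; rewrite !inE; case: (eqVneq i x) => [->|] //=.
      by rewrite xJ (negbTE xF).
    by ring.
  rewrite IH // -expectZ; apply: expect_eq => F sF; have xF := notin_subset xA sF.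
  rewrite /avg -[[disjoint x |: F & J]]setI_eq0 -!setI_eq0.
  have -> : ((x |: F) :&: J == set0) = false.
    by apply/negbTE/set0Pn; exists x; rewrite !inE eqxx.
  have -> : F :&: J = F :&: (J :\ x).
    apply/setP=> i; rewrite !inE; case: (eqVneq i x) => [->|] //=.
    by rewrite (negbTE xF).
  by case: eqP => _; rewrite /=; ring.
have sJA : J \subset A.
  apply/subsetP=> i iJ; move/subsetP/(_ i iJ): sJ; rewrite !inE.
  by case: eqP => // eix; rewrite -eix iJ in xJ.
transitivity ((1 - p) ^+ #|J| * expect p A (fun F => avg p x f (F :\: J))).
  congr (_ * _); apply: expect_eq => F sF; rewrite /avg; congr (p * f _ + _).
  by apply/setP=> i; rewrite !inE; case: (eqVneq i x) => [->|] //=; rewrite xJ.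
rewrite IH //; apply: expect_eq => F sF; rewrite /avg.
have -> : [disjoint x |: F & J] = [disjoint F & J].
  by rewrite -!setI_eq0 setIUl (_ : [set x] :&: J = set0) ?set0U //; apply/setP=> i;
    rewrite !inE; case: (eqVneq i x) => [->|] //=; rewrite (negbTE xJ).
ring.
Qed.

Lemma expect_setD_le p A J f : 0 <= p <= 1 / 2 -> J \subset A ->
  (forall F, 0 <= f F) ->
  expect p A (fun F => f (F :\: J)) <= 2 ^+ #|J| * expect p A f.
Proof.
move=> p02 sJ f0; have p01 : 0 <= p <= 1 by lra.
have q0 : 0 < (1 - p) ^+ #|J| by rewrite exprn_gt0; lra.
rewrite -(ler_pM2l q0) expect_setD //.
apply: le_trans (_ : _ <= expect p A f) _.
  apply: expect_le => // F _; have := f0 F.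
  by case: [disjoint _ & _]; rewrite ?mul1r ?mul0r.
rewrite mulrA -exprMn ler_peMl ?expect_ge0 //.
by rewrite exprn_ege1 //; lra.
Qed.

Lemma expect_setU p A J f : J \subset A ->
  p ^+ #|J| * expect p A (fun F => f (F :|: J)) =
  expect p A (fun F => (J \subset F)%:R * f F).
Proof.
elim/setU1_ind: A J f => [|x A xA IH] J f.
  by rewrite subset0 => /eqP->; rewrite cards0 !expect0 setU0 sub0set expr0.
move=> sJ; rewrite !expectU1 //.
have [xJ|xJ] := boolP (x \in J).
  have sJA : J :\ x \subset A.
    apply/subsetP=> i; rewrite !inE => /andP[ix iJ].
    by move/subsetP/(_ i iJ): sJ; rewrite !inE (negbTE ix).
  rewrite -{1}(setD1K xJ) cardsU1 !inE eqxx /= exprD expr1.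
  transitivity (p * (p ^+ #|J :\ x| * expect p A (fun F => (fun G => f (x |: G)) (F :|: (J :\ x))))).
    rewrite mulrA; congr (_ * _); apply: expect_eq => F sF; rewrite /avg.
    have -> : (x |: F) :|: J = x |: (F :|: (J :\ x)).
      by apply/setP=> i; rewrite !inE; case: (eqVneq i x) => [->|] //=; rewrite xJ orbT.
    have -> : F :|: J = x |: (F :|: (J :\ x)).
      by apply/setP=> i; rewrite !inE; case: (eqVneq i x) => [->|] //=; rewrite xJ orbT.
    by ring.
  rewrite (IH _ (fun G => f (x |: G))) // -expectZ; apply: expect_eq => F sF; have xF := notin_subset xA sF.
  rewrite /avg.
  have -> : (J \subset x |: F) = (J :\ x \subset F) by rewrite subDset.
  have -> : (J \subset F) = false.
    by apply/negbTE; apply: contra xF => /subsetP; apply.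
  by case: (_ \subset _); rewrite /=; ring.
have sJA : J \subset A.
  apply/subsetP=> i iJ; move/subsetP/(_ i iJ): sJ; rewrite !inE.
  by case: eqP => // eix; rewrite -eix iJ in xJ.
transitivity (p ^+ #|J| * expect p A (fun F => avg p x f (F :|: J))).
  by congr (_ * _); apply: expect_eq => F sF; rewrite /avg setUA.
rewrite IH //; apply: expect_eq => F sF; rewrite /avg.
have -> : (J \subset x |: F) = (J \subset F).
  apply/idP/idP => [/subsetP s|s]; last exact: subset_trans s (subsetUr _ _).
  apply/subsetP=> i iJ; move: (s i iJ); rewrite !inE.
  by case: eqP => // eix; rewrite -eix iJ in xJ.
ring.
Qed.

Lemma sum_subset_const J (a : R) : \sum_(U : {set T} | U \subset J) a = 2 ^+ #|J| * a.
Proof.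
rewrite sumr_const (eq_card (B := mem (powerset J))) => [|U]; last by rewrite !inE.
by rewrite card_powerset -[LHS]mulr_natl natrX.
Qed.

(** The derivative is a signed sum of 2^|J| values in [0, 1]: one factor of the square is bounded by
    the number of terms, the other by their sum. *)
Lemma sqr_diff_le J h F : (forall G, 0 <= h G <= 1) ->
  diff J h F ^+ 2 <= 2 ^+ #|J| * \sum_(U : {set T} | U \subset J) h (F :\: J :|: U).
Proof.
move=> h01; set s := \sum_(U : {set T} | _) _.
have le_s : `|diff J h F| <= s.
  apply: le_trans (ler_norm_sum _ _ _) _; apply: ler_sum => U _.
  by rewrite normrM normrX normrN1 expr1n mul1r ger0_norm //; case/andP: (h01 (F :\: J :|: U)).
have s0 : 0 <= s by apply: le_trans le_s.
have s2 : s <= 2 ^+ #|J|.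
  rewrite -[leRHS]mulr1 -sum_subset_const; apply: ler_sum => U _.
  by case/andP: (h01 (F :\: J :|: U)).
rewrite -[leLHS]real_normK ?num_real // expr2; exact: ler_pM (le_trans le_s s2) le_s.
Qed.

Lemma expect_sqr_diff_le p J h : 0 <= p <= 1 -> (forall G, 0 <= h G <= 1) ->
  Ex p (fun F => diff J h F ^+ 2) <=
  2 ^+ #|J| * \sum_(U : {set T} | U \subset J) Ex p (fun F => h (F :\: J :|: U)).
Proof.
move=> p01 h01; rewrite -expect_sum -expectZ; apply: expect_le => // F _.
exact: sqr_diff_le.
Qed.

Lemma expect_sqr_diff_le4 p J h : 0 <= p <= 1 -> (forall G, 0 <= h G <= 1) ->
  Ex p (fun F => diff J h F ^+ 2) <= 4 ^+ #|J|.
Proof.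
move=> p01 h01; apply: le_trans (expect_sqr_diff_le _ p01 h01) _.
have -> : 4 ^+ #|J| = 2 ^+ #|J| * (2 ^+ #|J| * 1) :> R.
  by rewrite mulr1 -exprMn; congr (_ ^+ _); ring.
rewrite ler_wpM2l ?exprn_ge0 // -sum_subset_const; apply: ler_sum => U _.
by rewrite -(expect1 p setT); apply: expect_le => // F _; case/andP: (h01 (F :\: J :|: U)).
Qed.

Section Noisy.
Variables (p : R) (h : {set T} -> R).
Hypothesis p01 : 0 < p < 1.
Let v := p * (1 - p).
Let a J := Ex p (fun F => diff J (noise p (1 / 2) setT h) F ^+ 2).
Let b J := Ex p (fun F => diff J h F ^+ 2).
Let e S := v ^+ #|S| * Ex p (diff S h) ^+ 2.

Let p01' : 0 <= p <= 1. Proof. by case/andP: p01 => /ltW-> /ltW->. Qed.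
Let v0 : 0 < v. Proof. by case/andP: p01 => ? ?; rewrite /v mulr_gt0 ?subr_gt0. Qed.
Let e0 S : 0 <= e S.
Proof. by rewrite mulr_ge0 ?sqr_ge0 ?exprn_ge0 // ltW. Qed.

Let aE J : v ^+ #|J| * a J = \sum_(S : {set T}) (J \subset S)%:R * ((1 / 4) ^+ #|S| * e S).
Proof.
rewrite parseval_diff ?subsetT //; apply: eq_big => [S|S _]; first by rewrite subsetT.
rewrite expect_diff_noise ?subsetT // -/v; congr (_ * _).
have -> : 1 / 4 = (1 / 2) ^+ 2 :> R by field.
by rewrite /e -exprM mulnC exprM; ring.
Qed.

Let bE J : v ^+ #|J| * b J = \sum_(S : {set T}) (J \subset S)%:R * e S.
Proof. by rewrite parseval_diff ?subsetT //; apply: eq_bigl => S; rewrite subsetT. Qed.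

Lemma noise_diff_le J : a J <= b J.
Proof.
rewrite -(ler_pM2l (exprn_gt0 #|J| v0)) aE bE; apply: ler_sum => S _.
by rewrite ler_wpM2l ?ler0n // ler_piMl // exprn_ile1 //; lra.
Qed.

(** A Fourier set [S] is counted at most 2^|S| times, while its squared coefficient has been damped
    by 4^-|S|. The extra noise of rate 1/2 is there for this summability. *)
Lemma sum_noise_diff_le J' :
  \sum_(J : {set T} | J' \subset J) v ^+ #|J| * a J <= v ^+ #|J'| * b J'.
Proof.
rewrite bE; under eq_bigr do rewrite aE.
rewrite exchange_big /=; apply: ler_sum => S _; rewrite -mulr_suml mulrA.
rewrite ler_wpM2r //.
have -> : \sum_(J : {set T} | J' \subset J) (J \subset S)%:R =
    \sum_(J : {set T} | (J' \subset J) && (J \subset S)) (1 : R).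
  by rewrite [RHS]big_mkcondr; apply: eq_bigr => J _; case: ifP.
have [sJ'|sJ'] := boolP (J' \subset S); last first.
  rewrite big_pred0 ?mul0r // => J; apply/negbTE; apply: contra sJ' => /andP[].
  exact: subset_trans.
apply: le_trans (_ : (\sum_(J : {set T} | J \subset S) 1) * (1 / 4) ^+ #|S| <= _).
  apply: ler_wpM2r; first by apply: exprn_ge0; lra.
  by rewrite [leLHS]big_mkcond [leRHS]big_mkcond; apply: ler_sum => J _; case: (J' \subset J); case: (J \subset S).
by rewrite sum_subset_const mulr1 -exprMn exprn_ile1 //; lra.
Qed.

(** In the sum over [J] from [noise_sqr_mul_le], one factor [a J] is replaced by [b J] and bounded
    by [eps], or crudely by 4^|J| if [J] contains some [J'] in [M]. The other factor is summed over
    all [J], respectively over the supersets of [J']. *)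
Lemma noise_fourth_moment_le (r eps : R) (M : pred {set T}) :
  p <= 1 / 2 -> 0 <= r <= 1 / 2 -> 8 * (3 * r ^+ 4) <= 1 -> 0 <= eps ->
  (forall G, 0 <= h G <= 1) ->
  (forall J, (2 * (3 * r ^+ 4)) ^+ #|J| * b J <= eps \/ exists2 J', M J' & J' \subset J) ->
  Ex p (fun F => noise p r setT (noise p (1 / 2) setT h) F ^+ 4) <=
  eps * Ex p (fun F => h F ^+ 2) +
  \sum_(J | M J) (8 * (3 * r ^+ 4)) ^+ #|J| * (v ^+ #|J| * b J).
Proof.
move=> p2 r02; set t := 3 * r ^+ 4 => t8 eps0 h01 cover.
have t0 : 0 <= t by rewrite /t mulr_ge0 ?exprn_ge0; lra.
have a0 J : 0 <= a J by apply: expect_ge0 => // F _; exact: sqr_ge0.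
have va0 J : 0 <= v ^+ #|J| * a J by rewrite mulr_ge0 ?exprn_ge0 // ltW.
(* Passing from p to v = p(1-p) costs the factor 2 in [2 * t]. *)
have pv : p <= 2 * v.
  have : 0 <= p * (1 - 2 * p) by case/andP: p01' => ? ?; rewrite mulr_ge0 //; lra.
  by rewrite /v; lra.
have E1 : Ex p (fun F => noise p r setT (noise p (1 / 2) setT h) F ^+ 4) <=
    \sum_(J : {set T}) (t * p) ^+ #|J| * (a J * a J).
  apply: le_trans (_ : _ <= Ex p (fun F => noise p r setT (noise p (1 / 2) setT h) F ^+ 2 *
     noise p r setT (noise p (1 / 2) setT h) F ^+ 2)) _.
    by apply: expect_le => // F _; rewrite -exprD.
  apply: le_trans (noise_sqr_mul_le _ _ _ _ r02) _ => //.
  by under eq_bigl do rewrite subsetT.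
apply: le_trans E1 _.
have E2 J : (t * p) ^+ #|J| * (a J * a J) <= (2 * t) ^+ #|J| * b J * (v ^+ #|J| * a J).
  rewrite mulrACA -exprMn mulrC [leRHS]mulrC.
  have p0 : 0 <= p by case/andP: p01'.
  have tp0 : 0 <= t * p by apply: mulr_ge0.
  rewrite ler_pM ?mulr_ge0 ?exprn_ge0 //.
    by rewrite ler_wpM2r // noise_diff_le.
  have tv0 : 0 <= 2 * t * v by apply: mulr_ge0 (ltW v0); apply: mulr_ge0.
  apply: lerXn2r => //.
  have -> : 2 * t * v = t * (2 * v) by ring.
  by rewrite ler_wpM2l.
have E3 J : (t * p) ^+ #|J| * (a J * a J) <= eps * (v ^+ #|J| * a J) +
   \sum_(J' | M J' && (J' \subset J)) (8 * t) ^+ #|J'| * (v ^+ #|J| * a J).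
  have S0 : 0 <= \sum_(J' | M J' && (J' \subset J)) (8 * t) ^+ #|J'| * (v ^+ #|J| * a J).
    by apply: sumr_ge0 => J' _; rewrite mulr_ge0 // exprn_ge0 // mulr_ge0.
  apply: le_trans (E2 J) _; have [le_eps|[J' MJ' sJ']] := cover J.
    by rewrite -[leLHS]addr0 lerD // ler_wpM2r.
  rewrite -[leLHS]add0r lerD ?(mulr_ge0 eps0 (va0 J)) //.
  rewrite (bigD1 J') /= ?MJ' ?sJ' // -[leLHS]addr0 lerD //; last first.
    by apply: sumr_ge0 => K _; rewrite mulr_ge0 // exprn_ge0 // mulr_ge0.
  rewrite ler_wpM2r //.
  apply: le_trans (_ : (8 * t) ^+ #|J| <= _).
    have -> : 8 * t = 2 * t * 4 by ring.
    rewrite [leRHS]exprMn ler_wpM2l //; last exact: expect_sqr_diff_le4.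
    by rewrite exprn_ge0 // mulr_ge0.
  apply: ler_wiXn2l => //; [exact: mulr_ge0 | exact: subset_leq_card].
apply: le_trans (ler_sum _ (fun J _ => E3 J)) _.
rewrite big_split -mulr_sumr /= lerD //.
  rewrite ler_wpM2l //; have le0 := sum_noise_diff_le set0; rewrite cards0 expr0 mul1r in le0.
  rewrite (eq_bigl _ _ (sub0set (T := T))) in le0.
  by apply: le_trans le0 _; apply: expect_le => // F _; rewrite diff0.
rewrite (exchange_big_dep M) /=; last by move=> J J' _ /andP[].
apply: ler_sum => J' MJ'; rewrite -mulr_sumr.
apply: ler_wpM2l; first by rewrite exprn_ge0 // mulr_ge0.
apply: le_trans (sum_noise_diff_le J'); rewrite le_eqVlt; apply/orP; left; apply/eqP.
by apply: eq_bigl => J; rewrite MJ'.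
Qed.

End Noisy.

(** Where [t F] exceeds [alpha], it is at most [alpha ^- 3 * t F ^+ 4]. Correlations with a noisy
    function are thereby reduced to its fourth moment. *)
Lemma expect_indicator_mul_le p h t (alpha : R) : 0 <= p <= 1 -> 0 < alpha ->
  (forall F, h F = 0 \/ h F = 1) ->
  Ex p (fun F => h F * t F) <= alpha * Ex p h + alpha ^- 3 * Ex p (fun F => t F ^+ 4).
Proof.
move=> p01 al0 h01; rewrite -!expectZ -expectD; apply: expect_le => // F _.
have t4 : 0 <= t F ^+ 4 by rewrite (exprM _ 2 2) sqr_ge0.
have al3 : 0 < alpha ^- 3 by rewrite invr_gt0 exprn_gt0.
have [->|->] := h01 F; first by rewrite mul0r mulr0 add0r mulr_ge0 // ltW.
rewrite mul1r mulr1; have [le|lt] := lerP (t F) alpha.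
  by rewrite -[leLHS]addr0 lerD // mulr_ge0 // ltW.
rewrite -[leLHS]add0r lerD ?(ltW al0) //.
rewrite mulrC ler_pdivlMr ?exprn_gt0 // [leRHS](exprS _ 3) ler_wpM2l ?(ltW (lt_trans al0 lt)) //.
have t0 := ltW (lt_trans al0 lt).
by apply: lerXn2r; rewrite ?nnegrE ?(ltW al0) ?(ltW lt).
Qed.

End CubeFourier.

(** * Russo's formula *)

Section Russo.
Variables (R : realType) (T : finType).
Implicit Types (p : R) (A F : {set T}) (f : {set T} -> R).

Lemma russo p A f :
  is_derive p 1 (fun t : R => expect t A f) (\sum_(c in A) expect p A (infl c f)).
Proof.
elim/setU1_ind: A f => [|x A xA IH] f.
  rewrite big_set0.
  rewrite (_ : (fun t : R => expect t set0 f) = cst (f set0)); first exact: is_derive_cst.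
  by apply/funext => t; rewrite expect0.
rewrite (_ : (fun t : R => expect t (x |: A) f) =
   (fun t => t * expect t A (fun F => f (x |: F)) + (1 - t) * expect t A f)); last first.
  by apply/funext => t; rewrite expectU1 // -!expectZ -expectD.
have H1 := IH (fun F => f (x |: F)); have H0 := IH f.
set g1 := fun t : R => expect t A (fun F => f (x |: F)) in H1 *.
set g0 := fun t : R => expect t A f in H0 *.
have HM1 := is_deriveM (is_derive_id p (1 : R)) H1.
have HM0 := is_deriveM (is_deriveB (is_derive_cst (1 : R) p 1) (is_derive_id p (1 : R))) H0.
apply: (is_derive_eq (is_deriveD HM1 HM0)); rewrite big_setU1 //=.
have -> : expect p (x |: A) (infl x f) = g1 p - g0 p.
  rewrite expectU1 // /g1 /g0 -[X in X - _]mul1r -mulN1r -expect_lin.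
  apply: expect_eq => F sF; rewrite /avg /infl setUA setUid.
  by rewrite setU1K ?(notin_subset xA) // setD1_notin ?(notin_subset xA) //; ring.
have -> : \sum_(c in A) expect p (x |: A) (infl c f) =
   p * \sum_(c in A) expect p A (infl c (fun F => f (x |: F))) +
   (1 - p) * \sum_(c in A) expect p A (infl c f).
  rewrite !mulr_sumr -big_split; apply: eq_bigr => c cA /=.
  rewrite expectU1 // -expect_lin; apply: expect_eq => F sF; rewrite /avg /infl.
  have -> : (x |: F) :\ c = x |: (F :\ c).
    apply/setP=> i; rewrite !inE; case: (eqVneq i x) => [->|] //=; rewrite andbT.
    by apply: contraNneq xA => ->.
  by rewrite setUCA.
rewrite (_ : (cst 1 - id) p = 1 - p) // /GRing.scale /=; ring.
Qed.

(** Stated for arbitrary real [f], since it is applied to a weighted combination that is not an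
    indicator. *)
Lemma expect_mvt (a b : R) A f : a < b -> exists2 p, a < p < b &
  expect b A f - expect a A f = (\sum_(c in A) expect p A (infl c f)) * (b - a).
Proof.
move=> ab.
have [||p pab E] := @MVT R (fun t : R => expect t A f)
    (fun p => \sum_(c in A) expect p A (infl c f)) a b ab.
- by move=> p _; exact: russo.
- apply: derivable_within_continuous => p _; exact: (@ex_derive _ _ _ _ _ _ _ (russo p A f)).
by exists p; rewrite // in_itv /= in pab.
Qed.

Definition monotone f := forall F G : {set T}, F \subset G -> f F <= f G.

Lemma infl_ge0 c f F : monotone f -> 0 <= infl c f F.
Proof.
by move=> fm; rewrite subr_ge0; apply: fm; rewrite (subset_trans (subD1set _ _)) // subsetUr.
Qed.

Lemma expect_mono (a b : R) A f : 0 <= a -> a <= b -> b <= 1 -> monotone f ->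
  expect a A f <= expect b A f.
Proof.
move=> a0 ab b1 fm; move: ab; rewrite le_eqVlt => /orP[/eqP-> //|ab].
have [p /andP[ap pb] E] := expect_mvt A f ab.
rewrite -subr_ge0 E mulr_ge0 ?subr_ge0 ?(ltW ab) //; apply: sumr_ge0 => c _.
by apply: expect_ge0 => [|F _]; [lra | exact: infl_ge0].
Qed.

End Russo.

(** * Constraints, literals and their symmetries *)

Section Literals.
Variables (n q k : nat).
Local Notation C := (constraint n q k).
Local Notation L := ('I_n * 'I_q)%type.
Implicit Types (c d : C) (F G J K U : {set C}) (s D : {set L}) (x y : assignment n q).

Definition vars c : {set 'I_n} := val (tag c).

(** Constraints and assignments both become sets of literals, and [forbids] becomes inclusion in the
    graph. *)
Definition lits c : {set L} :=
  [set (val i, tagged c i) | i : {i : 'I_n | i \in vars c}].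

Definition graph x : {set L} := [set l | x l.1 == l.2].

Definition functional s := {in s &, injective (@fst 'I_n 'I_q)}.

Lemma litsP c (l : L) : reflect (exists i : {i : 'I_n | i \in vars c}, l = (val i, tagged c i))
  (l \in lits c).
Proof. by apply: (iffP imsetP) => [[i _ ->]|[i ->]]; exists i. Qed.

Lemma functional_graph x : functional (graph x).
Proof.
move=> [i a] [j b]; rewrite !inE /= => /eqP <- /eqP <- /= ->.
by [].
Qed.

Lemma functional_sub s D : s \subset D -> functional D -> functional s.
Proof. by move=> /subsetP sD fD l l' /sD lD /sD; apply: fD. Qed.

Lemma functional_lits c : functional (lits c).
Proof.
by move=> l l' /litsP[i ->] /litsP[j ->] /= /val_inj ->.
Qed.

Lemma forbidsE c x : forbids c x = (lits c \subset graph x).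
Proof.
apply/forallP/subsetP => [h l /litsP[i ->]|h i]; first by rewrite inE; exact: h.
have := h (val i, tagged c i); rewrite inE => -> //.
by apply/litsP; exists i.
Qed.

Lemma fst_lits c : @fst _ _ @: lits c = vars c.
Proof.
apply/setP=> i; apply/imsetP/idP => [[l /litsP[j ->] ->]|ic]; first exact: (valP j).
by exists (i, tagged c (exist _ i ic)) => //; apply/litsP; exists (exist _ i ic).
Qed.

Lemma card_vars c : #|vars c| = k.
Proof. exact: (eqP (valP (tag c))). Qed.

Lemma card_lits c : #|lits c| = k.
Proof. by rewrite -(card_in_imset (functional_lits (c := c))) fst_lits card_vars. Qed.

Lemma lits_inj : injective lits.
Proof.
move=> c d E; have ES : tag c = tag d.
  by apply: val_inj; rewrite -[LHS]/(vars c) -[RHS]/(vars d) -!fst_lits E.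
case: c d E ES => [S a] [S' a'] E /= ES.
case: S' / ES a' E => a' E; congr (existT _ _ _); apply/ffunP => i.
have : (val i, a i) \in lits (existT _ S a : C) by apply/litsP; exists i.
by rewrite E => /litsP[j] /= [/val_inj <-].
Qed.

(** With [lits_inj], this identifies constraints with the functional sets of k literals, so that
    symmetries can be defined on literals. *)
Lemma lits_surj D : functional D -> #|D| = k -> exists c, lits c = D.
Proof.
move=> fD cD; pose S0 : {set 'I_n} := @fst _ _ @: D.
have cS : #|S0| == k by rewrite card_in_imset ?cD.
pose S : scope n k := exist _ S0 cS.
have exD (i : {i : 'I_n | i \in val S}) : exists l, (l \in D) && (l.1 == val i).
  by have /imsetP[l lD ->] := valP i; exists l; rewrite lD eqxx.
exists (existT _ S [ffun i => (xchoose (exD i)).2]).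
apply/setP=> l; apply/litsP/idP => [[i ->]|lD] /=.
  rewrite ffunE; have /andP[] := xchooseP (exD i).
  by case: (xchoose _) => l1 l2 /= lD /eqP <-.
have lS : l.1 \in val S by apply/imsetP; exists l.
exists (exist _ l.1 lS); rewrite /= ffunE.
have /andP[l'D /eqP e] := xchooseP (exD (exist _ l.1 lS)).
rewrite [LHS]surjective_pairing; congr (_, _).
by rewrite [in LHS](fD _ _ lD l'D).
Qed.

(** The second argument holds additional forbidden literals: a pair (i, a) in [s] demands that
    variable i avoid the value a. *)
Definition satisfiable F s :=
  [exists x : assignment n q,
    [forall c in F, ~~ (lits c \subset graph x)] && [forall l in s, l \notin graph x]].

Lemma satisfiableP F s : reflect
  (exists x, {in F, forall c, ~~ (lits c \subset graph x)} /\ {in s, forall l, l \notin graph x})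
  (satisfiable F s).
Proof.
apply: (iffP existsP) => [[x /andP[/forall_inP h1 /forall_inP h2]]|[x [h1 h2]]].
  by exists x.
by exists x; apply/andP; split; apply/forall_inP.
Qed.

Lemma satisfiable_sub F G s D : F \subset G -> s \subset D -> satisfiable G D -> satisfiable F s.
Proof.
move=> /subsetP FG /subsetP sD /satisfiableP[x [h1 h2]]; apply/satisfiableP; exists x.
by split=> [c /FG/h1|l /sD/h2].
Qed.

Lemma in_Cover F : (F \in Cover n q k) = ~~ satisfiable F set0.
Proof.
rewrite inE; apply/forallP/idP => [h|ns x].
  apply/satisfiableP => -[x [h1 _]]; have /existsP[c /andP[cF]] := h x.
  by rewrite forbidsE (negbTE (h1 c cF)).
apply: contraR ns => /existsPn h; apply/satisfiableP; exists x; split=> [c cF|l]; last by rewrite inE.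
by have := h c; rewrite cF /= forbidsE.
Qed.

Section Swap.
Variables (l1 l2 : L).

(** Values are relabelled only on the two exchanged variables, so a set of literals avoiding both
    variables is fixed. *)
Definition swap (l : L) : L :=
  (tperm l1.1 l2.1 l.1, if l.1 \in [set l1.1; l2.1] then tperm l1.2 l2.2 l.2 else l.2).

Lemma swapK : involutive swap.
Proof.
move=> [i a]; rewrite /swap /= tpermK; congr (_, _); rewrite !inE.
have [->|i1] := eqVneq i l1.1; first by rewrite tpermL eqxx !orbT tpermK.
have [->|i2] := eqVneq i l2.1; first by rewrite tpermR eqxx /= tpermK.
by rewrite tpermD ?(negbTE i1) ?(negbTE i2) // eq_sym ?(negbTE i1) ?(negbTE i2).
Qed.

Lemma swap_inj : injective swap. Proof. exact: can_inj swapK. Qed.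

Lemma swap1 : swap l1 = l2.
Proof. by rewrite /swap !inE eqxx !tpermL; case: l2. Qed.

Lemma swap_out l : l.1 != l1.1 -> l.1 != l2.1 -> swap l = l.
Proof.
move=> i1 i2; rewrite /swap !inE (negbTE i1) (negbTE i2) tpermD 1?eq_sym //.
by case: l {i1 i2}.
Qed.

Lemma mem_swap (l : L) D : (l \in swap @: D) = (swap l \in D).
Proof. by rewrite -{1}(swapK l) mem_imset //; exact: swap_inj. Qed.

Lemma functional_swap D : functional D -> functional (swap @: D).
Proof.
move=> fD _ _ /imsetP[l lD ->] /imsetP[l' l'D ->] /= /perm_inj e.
by rewrite (fD _ _ lD l'D e).
Qed.

Lemma swapC_ex c : exists d, lits d == swap @: lits c.
Proof.
have [|d Ed] := @lits_surj (swap @: lits c) (functional_swap (@functional_lits c)).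
  by rewrite card_imset ?card_lits //; exact: swap_inj.
by exists d; apply/eqP.
Qed.

(** Choosing a constraint with the right literals avoids transporting a dependent function between
    scopes. *)
Definition swapC c : C := xchoose (swapC_ex c).

Lemma lits_swapC c : lits (swapC c) = swap @: lits c.
Proof. exact/eqP/(xchooseP (swapC_ex c)). Qed.

Lemma swapCK : involutive swapC.
Proof.
move=> c; apply: lits_inj; rewrite !lits_swapC -imset_comp.
by rewrite (eq_imset (g := id)) ?imset_id //; exact: swapK.
Qed.

Definition swapA x : assignment n q :=
  [ffun j => if j \in [set l1.1; l2.1] then tperm l1.2 l2.2 (x (tperm l1.1 l2.1 j)) else x j].

Lemma graph_swapA x : graph (swapA x) = swap @: graph x.
Proof.
apply/setP=> l; rewrite mem_swap !inE ffunE /swap /= !inE.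
case: ifP => h; first by rewrite -(inj_eq (perm_inj (s := tperm l1.2 l2.2))) tpermK.
by move/negbT: h; rewrite negb_or => /andP[h1 h2]; rewrite tpermD // eq_sym.
Qed.

Lemma satisfiable_swap F s : satisfiable F s -> satisfiable (swapC @: F) (swap @: s).
Proof.
case/satisfiableP=> x [h1 h2]; apply/satisfiableP; exists (swapA x); split.
  move=> _ /imsetP[c cF ->]; rewrite lits_swapC graph_swapA.
    apply: contra (h1 c cF) => /subsetP sub; apply/subsetP => l lc.
    by have := sub _ (imset_f swap lc); rewrite mem_swap swapK.
by move=> l; rewrite mem_swap graph_swapA mem_swap => /h2.
Qed.

End Swap.

Section Unsat.
Variable R : realType.
Local Notation Ex p := (expect p [set: C]).

Definition unsat s F : R := (~~ satisfiable F s)%:R.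

Lemma unsat01 s F : 0 <= unsat s F <= 1.
Proof. by rewrite /unsat; case: satisfiable; rewrite ?lexx ?ler01. Qed.

Lemma unsat_sub F G s D : F \subset G -> s \subset D -> unsat s F <= unsat D G.
Proof.
move=> FG sD; rewrite /unsat ler_nat; have := @satisfiable_sub F G s D FG sD.
by case: (satisfiable G D) => [/(_ isT)->|_] //; case: (satisfiable F s).
Qed.

Lemma monotone_unsat s : monotone (unsat s).
Proof. by move=> F G FG; apply: unsat_sub. Qed.

Lemma mu_Cover (p : R) : mu p (Cover n q k) = Ex p (unsat set0).
Proof.
rewrite /mu /expect big_mkcond; apply: eq_big => [F|F _]; first by rewrite subsetT.
rewrite in_Cover /unsat /weight; case: (satisfiable F set0) => /=; rewrite ?mulr1 ?mulr0 //.
by apply: eq_bigl => c; rewrite in_setT.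
Qed.

Lemma expect_imset (phi : C -> C) p (f : {set C} -> R) : involutive phi ->
  Ex p (fun F => f (phi @: F)) = Ex p f.
Proof.
move=> phiK; have inj := can_inj phiK.
have imK (F : {set C}) : phi @: (phi @: F) = F.
  by rewrite -imset_comp (eq_imset (g := id)) ?imset_id //; exact: phiK.
rewrite /expect [RHS](reindex_onto (fun F : {set C} => phi @: F) (fun F : {set C} => phi @: F)) //=.
apply: eq_big => [F|F _]; first by rewrite !subsetT imK eqxx.
congr (_ * _); rewrite /weight [RHS](reindex_onto phi phi) //=.
apply: eq_big => [c|c _]; first by rewrite !in_setT phiK eqxx.
by rewrite mem_imset.
Qed.

Definition lvars s : {set 'I_n} := @fst _ _ @: s.

Lemma expect_unsat_swap p s (l1 l2 : L) : l1.1 \notin lvars s -> l2.1 \notin lvars s ->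
  Ex p (unsat (l1 |: s)) = Ex p (unsat (l2 |: s)).
Proof.
move=> n1 n2; rewrite -(expect_imset _ _ (swapCK l1 l2)); apply: expect_eq => F _.
have Es : swap l1 l2 @: s = s.
  rewrite -[RHS]imset_id; apply: eq_in_imset => l ls; apply: swap_out.
    by apply: contraNneq n1 => <-; apply: imset_f.
  by apply: contraNneq n2 => <-; apply: imset_f.
have E1 : swap l1 l2 @: (l1 |: s) = l2 |: s by rewrite imsetU1 swap1 Es.
have imK (X : finType) (g : X -> X) (A : {set X}) : involutive g -> g @: (g @: A) = A.
  by move=> gK; rewrite -imset_comp (eq_imset (g := id)) ?imset_id.
congr (~~ _)%:R; apply/idP/idP => /(satisfiable_swap l1 l2).
  by rewrite E1 imK //; exact: swapCK.
by rewrite -E1 imK //; exact: swapK.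
Qed.

End Unsat.

End Literals.

(** * Forbidden literals, forced literals and distinct representatives *)

Section Killing.
Variables (R : realType) (n q k : nat).
Local Notation C := (constraint n q k).
Local Notation L := ('I_n * 'I_q)%type.
Local Notation Ex p := (expect p [set: C]).
Local Notation unsat := (@unsat n q k R).
Local Notation satisfiable := (@satisfiable n q k).
Implicit Types (p : R) (c d : C) (F G J K U : {set C}) (s D : {set L}).

Lemma card_lvars s : functional s -> #|lvars s| = #|s|.
Proof. exact: card_in_imset. Qed.

Lemma functionalU1 (l : L) s : functional s -> l.1 \notin lvars s -> functional (l |: s).
Proof.
move=> fs ls x y; rewrite !inE => /orP[/eqP->|xs] /orP[/eqP->|ys] // e.
- by case/negP: ls; rewrite e; apply: imset_f.
- by case/negP: ls; rewrite -e; apply: imset_f.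
- exact: fs.
Qed.

Lemma functional0 : functional (set0 : {set L}).
Proof. by move=> x y; rewrite inE. Qed.

(** An exchange argument: literals of [s] are traded one at a time for literals of [D], each trade
    being a symmetry of the product measure. *)
Lemma expect_unsat_card p s D : functional s -> functional D -> #|s| = #|D| ->
  Ex p (unsat s) = Ex p (unsat D).
Proof.
have [m] := ubnP #|D :\: s|; elim: m s => // m IHm s ltm fs fD cs.
have [D0|[l' l'Ds]] := set_0Vmem (D :\: s).
  suff -> : D = s by [].
  by apply/eqP; rewrite eqEcard cs leqnn andbT -setD_eq0 D0.
move: (l'Ds); rewrite inE => /andP[l's l'D].
(* The literal given up is the one of [s] on the variable of [l'] if there is one, and otherwise any
   literal of [s] outside [D]. *)
have [l [ls lD ll']] : exists l, [/\ l \in s, l \notin D & l'.1 \notin lvars (s :\ l)].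
  have [/imsetP[l ls e]|nl'] := boolP (l'.1 \in lvars s).
    exists l; split=> //.
      by apply: contra l's => lD; rewrite (fD _ _ l'D lD e).
    apply/imsetP => -[x]; rewrite !inE => /andP[xl xs] e'.
    by case/negP: xl; apply/eqP; apply: fs => //; rewrite -e' e.
  have /card_gt0P[l] : (0 < #|s :\: D|)%N.
    by rewrite cardsD setIC cs -cardsD card_gt0; apply/set0Pn; exists l'.
  rewrite inE => /andP[lD ls]; exists l; split=> //.
  by apply: contra nl'; apply/subsetP/imsetS/subD1set.
have fs' : functional (s :\ l) by apply: functional_sub fs; apply: subD1set.
have ll : l.1 \notin lvars (s :\ l).
  apply/imsetP => -[x]; rewrite !inE => /andP[xl xs] e.
  by case/negP: xl; apply/eqP; apply: fs.
have l's' : l' \notin s :\ l by apply: contra l's => /setD1P[].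
rewrite -(setD1K ls) (expect_unsat_swap k p ll ll') IHm //.
- rewrite -ltnS; apply: leq_trans ltm; rewrite ltnS; apply: proper_card.
  apply/properP; split; last by exists l'; rewrite // !inE eqxx.
  apply/subsetP => x; rewrite !inE => /andP[h xD]; rewrite xD andbT.
  apply: contra h => xs; rewrite xs andbT orbC.
  by have -> : x != l by apply: contraNneq lD => <-.
- exact: functionalU1.
- by rewrite cardsU1 l's' -cs (cardsD1 l s) ls.
Qed.

(** For a satisfiable instance these are forced literals: every solution contains them, by
    [kill_graph]. *)
Definition kill s F : {set L} := [set l | (l.1 \notin lvars s) && ~~ satisfiable F (l |: s)].

Lemma sum_unsatU1 s F :
  \sum_(l : L | l.1 \notin lvars s) (unsat (l |: s) F - unsat s F) =
  (satisfiable F s)%:R * #|kill s F|%:R.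
Proof.
have [st|ns] := boolP (satisfiable F s).
  rewrite mul1r -sum1_card natr_sum big_mkcond [RHS]big_mkcond; apply: eq_bigr => l _.
  by rewrite inE /unsat st subr0; case: (_ \notin _); case: satisfiable.
rewrite mul0r; apply: big1 => l _; rewrite /unsat ns.
by rewrite (contraNN (satisfiable_sub (subxx F) (subsetUr [set l] s)) ns) subrr.
Qed.

Lemma card_notin_lvars s : functional s ->
  #|[set l : L | l.1 \notin lvars s]| = ((n - #|s|) * q)%N.
Proof.
move=> fs; rewrite -(card_lvars fs).
have -> : [set l : L | l.1 \notin lvars s] = setX (~: lvars s) [set: 'I_q].
  by apply/setP=> l; rewrite !inE andbT.
by rewrite cardsX cardsCs setCK cardsT !card_ord.
Qed.

Lemma kill_graph s F x : {in F, forall c, ~~ (lits c \subset graph x)} ->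
  {in s, forall l, l \notin graph x} -> kill s F \subset graph x.
Proof.
move=> h1 h2; apply/subsetP => l; rewrite inE => /andP[_]; apply: contraR => lx.
by apply/satisfiableP; exists x; split=> // m /setU1P[->|/h2].
Qed.

Lemma card_graph (x : assignment n q) : #|graph x| = n.
Proof.
have -> : graph x = [set (i, x i) | i : 'I_n].
  apply/setP => l; rewrite inE; apply/eqP/imsetP => [e|[i _ ->] //].
  by exists l.1 => //; rewrite e; case: l {e}.
by rewrite card_imset ?card_ord // => i j [].
Qed.

Lemma card_kill_le s F : satisfiable F s -> (#|kill s F| <= n)%N.
Proof.
case/satisfiableP=> x [h1 h2]; apply: leq_trans (eq_leq (card_graph x)).
exact/subset_leq_card/kill_graph.
Qed.

Lemma card_lits_subset D : functional D ->
  #|[set c : C | lits c \subset D]| = 'C(#|D|, k).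
Proof.
move=> fD; rewrite -cards_draws -(card_imset _ (@lits_inj n q k)); apply: eq_card => s.
rewrite inE; apply/imsetP/andP => [[c]|[sD /eqP cs]].
  by rewrite inE => sc ->; rewrite card_lits.
by have [c cE] := lits_surj (functional_sub sD fD) cs; exists c; rewrite // inE cE.
Qed.

(** Adding a constraint made of forced literals excludes every solution, so it is pivotal. The
    forced literals lie in the graph of one solution, hence any k of them form a constraint. *)
Lemma kill_infl s F : satisfiable F s ->
  'C(#|kill s F|, k)%:R <= \sum_c infl c (unsat s) F.
Proof.
move=> st; have /satisfiableP[x [h1 h2]] := st; have sub := kill_graph h1 h2.
rewrite -(card_lits_subset (functional_sub sub (@functional_graph _ _ x))).
rewrite -sum1_card natr_sum [leRHS](bigID (fun c => c \in [set c : C | lits c \subset kill s F])) /=.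
rewrite -[leLHS]addr0 lerD ?sumr_ge0 // => [|c _]; last exact/infl_ge0/monotone_unsat.
apply: ler_sum => c; rewrite inE => sc; rewrite /infl /unsat.
rewrite (satisfiable_sub (subD1set F c) (subxx s) st) /= subr0.
suff -> : satisfiable (c |: F) s = false by [].
apply/negbTE/satisfiableP => -[y [g1 g2]].
have /negP[] := g1 c (setU11 _ _); apply: subset_trans sc _.
by apply: kill_graph => // d dF; apply: g1; apply: setU1r.
Qed.

(** By symmetry all fresh literals give the same increment, so the left side is the mean number of
    forced literals on satisfiable instances. Either at most [B] are forced, or at most n are while
    at least 'C(B, k) constraints are pivotal. *)
Lemma unsat_increment_le p s (l : L) (B : nat) : 0 <= p <= 1 ->
  functional s -> l.1 \notin lvars s -> (k <= B)%N ->
  ((n - #|s|) * q)%:R * (Ex p (unsat (l |: s)) - Ex p (unsat s)) <=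
  B%:R + n%:R / 'C(B, k)%:R * \sum_c Ex p (infl c (unsat s)).
Proof.
move=> p01 fs ls kB.
have -> : ((n - #|s|) * q)%:R * (Ex p (unsat (l |: s)) - Ex p (unsat s)) =
    Ex p (fun F => (satisfiable F s)%:R * #|kill s F|%:R).
  transitivity (Ex p (fun F => \sum_(l0 : L | l0.1 \notin lvars s) (unsat (l0 |: s) F - unsat s F))).
    rewrite expect_sum -(card_notin_lvars fs) mulr_natl -sumr_const.
    apply: eq_big => [l'|l']; rewrite inE // => l's.
    rewrite (expect_unsat_swap k p ls l's) -[X in X - _]mul1r -mulN1r -expect_lin.
    by apply: expect_eq => F _; rewrite mul1r mulN1r.
  by apply: expect_eq => F _; exact: sum_unsatU1.
have EB : Ex p (fun=> B%:R) = B%:R.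
  transitivity (Ex p (fun F => B%:R * 1)); first by apply: expect_eq => F _; rewrite mulr1.
  by rewrite expectZ expect1 mulr1.
rewrite -expect_sum -expectZ -EB -expectD; apply: expect_le => // F _.
have B0 : (0 : R) < 'C(B, k)%:R by rewrite ltr0n bin_gt0.
have I0 : 0 <= \sum_c infl c (unsat s) F.
  by apply: sumr_ge0 => c _; exact/infl_ge0/monotone_unsat.
have N0 : 0 <= n%:R / 'C(B, k)%:R * \sum_c infl c (unsat s) F.
  by rewrite mulr_ge0 ?divr_ge0 ?ler0n.
have [st|_] := boolP (satisfiable F s); last by rewrite mul0r addr_ge0 ?ler0n.
rewrite mul1r; have [leB|ltB] := leqP #|kill s F| B.
  by rewrite -[leLHS]addr0 lerD ?ler_nat.
rewrite -[leLHS]add0r lerD ?ler0n //.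
apply: le_trans (_ : n%:R <= _); first by rewrite ler_nat card_kill_le.
rewrite -mulrA ler_peMr ?ler0n // mulrC ler_pdivlMr // mul1r.
apply: le_trans (kill_infl st); rewrite ler_nat.
exact: leq_bin2l (ltnW ltB).
Qed.

(** A system of distinct representatives for the variable sets; finite functions make it a
    boolean. *)
Definition sdr J :=
  [exists l : {ffun C -> 'I_n}, [forall c in J, l c \in vars c] &&
    [forall c in J, forall d in J, (l c == l d) ==> (c == d)]].

Lemma sdrP J : reflect (exists2 l : C -> 'I_n, {in J, forall c, l c \in vars c} & {in J &, injective l})
  (sdr J).
Proof.
apply: (iffP existsP) => [[l /andP[/forall_inP h1 /forall_inP h2]]|[l h1 h2]].
  exists l => // c d cJ dJ e; apply/eqP.
  by move/forall_inP: (h2 c cJ) => /(_ d dJ); rewrite e eqxx.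
exists (finfun l); apply/andP; split; first by apply/forall_inP => c cJ; rewrite ffunE h1.
apply/forall_inP => c cJ; apply/forall_inP => d dJ; rewrite !ffunE.
by apply/implyP => /eqP e; rewrite (h2 c d).
Qed.

Lemma sdr_sub J K : K \subset J -> sdr J -> sdr K.
Proof.
move=> /subsetP KJ /sdrP[l h1 h2]; apply/sdrP; exists l => [c /KJ/h1 //|c d /KJ cJ /KJ dJ].
exact: h2.
Qed.

Definition dense J := (#|nbhd (@vars n q k) J| < #|J|)%N.

Lemma not_sdr_dense J : (0 < n)%N -> ~~ sdr J -> exists2 K : {set C}, K \subset J & dense K.
Proof.
move=> n0 nJ; have /existsP[K /andP[sK dK]] : [exists K : {set C}, (K \subset J) && dense K].
  apply: contraR nJ => /existsPn h; apply/sdrP; apply: (hall_marriage (Ordinal n0)) => K sK.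
  by have := h K; rewrite sK /dense -leqNgt.
by exists K.
Qed.

Lemma sdr_lits J : sdr J ->
  exists s, [/\ functional s, #|s| = #|J| & {in J, forall c, exists2 l, l \in s & l \in lits c}].
Proof.
case/sdrP=> v h1 h2.
have exl c : c \in J -> exists2 l, l \in lits c & v c = l.1.
  by move=> /h1; rewrite -fst_lits => /imsetP.
have [->|[c0 c0J]] := set_0Vmem J.
  by exists set0; split=> [||c]; rewrite ?cards0 ?inE //; exact: functional0.
have [l0 _ _] := exl c0 c0J.
pose l c := odflt l0 [pick l in lits c | v c == l.1].
have lP c : c \in J -> l c \in lits c /\ v c = (l c).1.
  move=> cJ; rewrite /l; case: pickP => [x /andP[? /eqP ?] //|h].
  by have [x xc e] := exl c cJ; have := h x; rewrite xc e eqxx.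
exists (l @: J); split.
- move=> _ _ /imsetP[c cJ ->] /imsetP[d dJ ->] e; congr l; apply: h2 => //.
  by rewrite (lP c cJ).2 (lP d dJ).2.
- rewrite card_in_imset // => c d cJ dJ e; apply: h2 => //.
  by rewrite (lP c cJ).2 (lP d dJ).2 e.
- by move=> c cJ; exists (l c); [exact: imset_f | exact: (lP c cJ).1].
Qed.

(* Falsifying one literal of each constraint of [c |: U] satisfies all of them,
   so the pivotality of [c] is charged to the literals of [s]. *)
Lemma infl_sdr_le c U J F s : U \subset J ->
  {in c |: U, forall d, exists2 l, l \in s & l \in lits d} ->
  infl c (unsat set0) (F :\: J :|: U) <=
  unsat s (F :\: (c |: J)) - unsat set0 (F :\: (c |: J)).
Proof.
move=> UJ hs; apply: lerB; last first.
  apply: unsat_sub => //; apply/subsetP => d; rewrite !inE negb_or.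
  by move=> /andP[/andP[-> ->] ->].
rewrite /unsat ler_nat.
suff : satisfiable (F :\: (c |: J)) s -> satisfiable (c |: (F :\: J :|: U)) set0.
  by case: (satisfiable _ s) => [/(_ isT)->|_] //; case: (satisfiable _ _).
case/satisfiableP=> x [h1 h2]; apply/satisfiableP; exists x; split=> [d|l]; last by rewrite inE.
have [dcU _|dcU] := boolP (d \in c |: U).
  have [l ls ld] := hs d dcU; apply: contra (h2 l ls) => /subsetP; exact.
move=> dF; apply: h1; move: dcU dF; rewrite !inE negb_or => /andP[/negbTE-> /negbTE->].
by rewrite orbF negb_or.
Qed.

(** The mean of [infl_sdr_le]: deleting [c |: J] costs a factor 2 per constraint, and what remains
    is the effect of forbidding |U| + 1 literals. *)
Lemma expect_infl_sdr_le p c U J (r0 : nat) (kappa : R) : 0 <= p <= 1 / 2 ->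
  (forall s, functional s -> (#|s| <= r0)%N ->
    Ex p (unsat s) - Ex p (unsat set0) <= kappa) ->
  c \notin J -> U \subset J -> sdr (c |: U) -> (#|U| < r0)%N ->
  Ex p (fun F => infl c (unsat set0) (F :\: J :|: U)) <= 2 ^+ #|J|.+1 * kappa.
Proof.
move=> p02 hk cJ UJ sU cardU; have p01 : 0 <= p <= 1 by lra.
have [s [fs cs hs]] := sdr_lits sU.
have cU : c \notin U by apply: notin_subset UJ.
have scard : (#|s| <= r0)%N by rewrite cs cardsU1 cU.
pose g G := unsat s G - unsat set0 G.
apply: le_trans (_ : Ex p (fun F => g (F :\: (c |: J))) <= _).
  by apply: expect_le => // F _; apply: infl_sdr_le.
have g0 F : 0 <= g F by rewrite subr_ge0 unsat_sub // sub0set.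
apply: le_trans (expect_setD_le p02 (subsetT _) g0) _.
rewrite cardsU1 cJ add1n ler_wpM2l ?exprn_ge0 //.
apply: le_trans (hk s fs scard); rewrite le_eqVlt; apply/orP; left; apply/eqP.
rewrite -[X in _ = X - _]mul1r -mulN1r -expect_lin.
by apply: expect_eq => F _; rewrite mul1r mulN1r.
Qed.

End Killing.

(** * Globalness of the pivotal events *)

Section Pivotal.
Variables (R : realType) (n q k : nat).
Local Notation C := (constraint n q k).
Local Notation L := ('I_n * 'I_q)%type.
Local Notation Ex p := (expect p [set: C]).
Local Notation unsat := (@unsat n q k R).
Implicit Types (p : R) (c d : C) (F G J K U : {set C}) (s D : {set L}).

Lemma infl_unsat01 c s F : infl c (unsat s) F = 0 \/ infl c (unsat s) F = 1.
Proof.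
have := infl_ge0 c F (@monotone_unsat n q k R s).
rewrite /infl /unsat; case: satisfiable; case: satisfiable => /=; rewrite ?subrr ?subr0; auto.
by rewrite sub0r oppr_ge0 ler10.
Qed.

Section Classify.
Variables (p r : R) (r0 : nat) (kappa : R) (c : C).
Let t := 3 * r ^+ 4.
Let h := infl c (unsat set0).
Let b J := Ex p (fun F => diff J h F ^+ 2).
Hypotheses (p0 : 0 < p) (p2 : p <= 1 / 2) (r_ge0 : 0 <= r) (r_le : r <= 1 / 2).
Hypotheses (t64 : 64 * t <= 1) (n_gt0 : (0 < n)%N).
Hypothesis kappaP : forall s, functional s -> (#|s| <= r0)%N ->
  Ex p (unsat s) - Ex p (unsat set0) <= kappa.

Let p01 : 0 < p < 1. Proof. by rewrite p0 (le_lt_trans p2) //; lra. Qed.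
Let p01' : 0 <= p <= 1. Proof. by case/andP: p01 => /ltW-> /ltW->. Qed.
Let p02 : 0 <= p <= 1 / 2. Proof. by rewrite (ltW p0). Qed.
Let t0 : 0 <= t. Proof. by rewrite /t mulr_ge0 // exprn_ge0. Qed.

Let h01 F : 0 <= h F <= 1.
Proof. by rewrite /h; case: (infl_unsat01 c set0 F) => ->; rewrite ?lexx ?ler01. Qed.

Let kappa0 : 0 <= kappa.
Proof. by have := kappaP (@functional0 n q); rewrite cards0 subrr; apply. Qed.

Let b0 J : 0 <= b J.
Proof. by apply: expect_ge0 => // F _; apply: sqr_ge0. Qed.

(** The minimal obstructions to the argument by literals; each proper subset still has distinct
    representatives together with [c]. *)
Definition min_bad J := [&& c \notin J, (#|J| < r0)%N, ~~ sdr (c |: J) &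
  [forall U : {set C}, (U \proper J) ==> sdr (c |: U)]].

(** A Hall violator inside [c |: J] has no distinct representatives, so by minimality it is [c |: J]
    if it contains [c], and [J] otherwise. *)
Lemma min_bad_dense J : min_bad J -> dense J || dense (c |: J).
Proof.
case/and4P=> cJ _ nJ /forallP minJ; have [K sK dK] := not_sdr_dense n_gt0 nJ.
have nK : ~~ sdr K.
  apply/sdrP => -[l h1 h2]; move: dK; rewrite /dense ltnNge.
  have <- : #|l @: K| = #|K| by apply: card_in_imset.
  move=> /negP[]; apply: subset_leq_card; apply/subsetP => _ /imsetP[d dK ->].
  by apply/bigcupP; exists d => //; apply: h1.
have [cK|cK] := boolP (c \in K).
  suff -> : c |: J = K by rewrite dK orbT.
  apply/eqP; rewrite eq_sym eqEsubset sK subUset sub1set cK /=.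
  apply: contraR nK => nJK; have := minJ (K :\ c).
  rewrite setD1K // => /implyP; apply; rewrite properE subDset sK /=.
  by apply: contra nJK => /subset_trans; apply; apply: subD1set.
suff <- : K = J by rewrite dK.
have sKJ : K \subset J.
  apply/subsetP => d dK'; move/subsetP/(_ d dK'): sK; rewrite !inE.
  by case: eqP => // e; rewrite -e dK' in cK.
apply/eqP; rewrite eqEproper sKJ /=; apply: contra nK => pK.
apply: sdr_sub (implyP (minJ K) pK); exact: subsetUr.
Qed.

(** Squaring, counting the sets [U] and deleting [J] cost 2^|J| each, and deleting [c] one more 2;
    with the weight this is absorbed by 16 t <= 1. *)
Lemma diff_sdr_le J : c \notin J -> (#|J| < r0)%N -> sdr (c |: J) ->
  (2 * t) ^+ #|J| * b J <= 2 * kappa.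
Proof.
move=> cJ ltJ sJ; apply: le_trans (_ : (16 * t) ^+ #|J| * (2 * kappa) <= _); last first.
  apply: ler_piMl; first exact: mulr_ge0.
  by apply: exprn_ile1; [exact: mulr_ge0 | have := t0; have := t64; lra].
have -> : 16 * t = 2 * t * 8 by ring.
rewrite [(2 * t * 8) ^+ _]exprMn -[leRHS]mulrA; apply: ler_wpM2l.
  by apply: exprn_ge0; exact: mulr_ge0.
apply: le_trans (expect_sqr_diff_le _ p01' h01) _.
apply: le_trans (_ : 2 ^+ #|J| * \sum_(U : {set C} | U \subset J) (2 ^+ #|J|.+1 * kappa) <= _).
  apply: ler_wpM2l; first exact: exprn_ge0.
  apply: ler_sum => U UJ; apply: (expect_infl_sdr_le p02 kappaP cJ UJ).
    by apply: sdr_sub sJ; apply: setUS.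
  by apply: leq_ltn_trans ltJ; apply: subset_leq_card.
have -> : 8 ^+ #|J| = 2 ^+ #|J| * 2 ^+ #|J| * 2 ^+ #|J| :> R.
  by rewrite -!exprMn; congr (_ ^+ _); ring.
rewrite sum_subset_const; move: #|J| => m; rewrite [2 ^+ m.+1]exprS.
by move: (2 ^+ m) => z; rewrite le_eqVlt; apply/orP; left; apply/eqP; ring.
Qed.

(** Harmless are the [J] containing [c], where the derivative vanishes, those with at least [r0]
    elements, where (8t)^|J| is tiny, and those with representatives. Any other contains a minimal
    obstruction. *)
Lemma cover_min_bad J :
  (2 * t) ^+ #|J| * b J <= (1 / 2) ^+ r0 + 2 * kappa \/ exists2 J', min_bad J' & J' \subset J.
Proof.
have half0 : 0 <= (1 / 2) ^+ r0 :> R by rewrite exprn_ge0 //; lra.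
have eps0 : 0 <= (1 / 2) ^+ r0 + 2 * kappa by rewrite addr_ge0 // mulr_ge0.
have [cJ|cJ] := boolP (c \in J).
  left; rewrite /b (@expect_eq _ _ _ _ _ (fun=> 0 * 1)) => [|F _].
    by rewrite expectZ mul0r mulr0.
  by rewrite diff_infl0 // expr0n mul0r.
have [leJ|ltJ] := leqP r0 #|J|.
  left; rewrite -[leLHS]addr0 lerD ?mulr_ge0 //.
  apply: le_trans (_ : (8 * t) ^+ #|J| <= _).
    have -> : 8 * t = 2 * t * 4 by ring.
    rewrite [leRHS]exprMn; apply: ler_wpM2l; last exact: expect_sqr_diff_le4.
    by apply: exprn_ge0; exact: mulr_ge0.
  apply: le_trans (_ : (1 / 2) ^+ #|J| <= _).
    apply: lerXn2r; rewrite ?nnegrE; [exact: mulr_ge0 | lra |].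
    by have := t0; have := t64; lra.
  by apply: ler_wiXn2l leJ; lra.
have [sJ|nJ] := boolP (sdr (c |: J)).
  by left; rewrite -[leLHS]add0r lerD // diff_sdr_le.
right; have [J' /minsetP[nJ' minJ'] sJ'] := @minset_exists _ (fun U => ~~ sdr (c |: U)) J nJ.
exists J' => //; apply/and4P; split=> //.
- exact: notin_subset sJ'.
- exact: leq_ltn_trans (subset_leq_card sJ') ltJ.
apply/forallP => U; apply/implyP => pU; apply: contraT => nU.
by have e := minJ' U nU (proper_sub pU); rewrite e properxx in pU.
Qed.

Let v := p * (1 - p).

Let v_le J : v ^+ #|J| * b J <= p ^+ #|J| * b J.
Proof.
apply: ler_wpM2r => //; have v0 : 0 <= v by apply: mulr_ge0; have := p01'; lra.
apply: lerXn2r; rewrite ?nnegrE ?(ltW p0) //.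
by rewrite /v ler_piMr ?(ltW p0) //; have := p0; lra.
Qed.

(** Only [U = J] escapes the argument by literals; the factor p^|J| turns its share into the
    probability that [J] is selected and [c] is pivotal. *)
Lemma min_bad_term_le J : min_bad J -> (8 * t) ^+ #|J| * (v ^+ #|J| * b J) <=
  2 * kappa * (64 * t * p) ^+ #|J| +
  (64 * t) ^+ #|J| * Ex p (fun F => (J \subset F)%:R * h F).
Proof.
case/and4P=> cJ ltJ _ /forallP minJ.
apply: le_trans (_ : (8 * t) ^+ #|J| * (p ^+ #|J| * b J) <= _).
  by apply: ler_wpM2l => //; apply: exprn_ge0; exact: mulr_ge0.
apply: le_trans (_ : (8 * t) ^+ #|J| * (p ^+ #|J| * (2 ^+ #|J| *
   (Ex p (fun F => h (F :|: J)) + 2 ^+ #|J| * (2 ^+ #|J|.+1 * kappa)))) <= _).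
  apply: ler_wpM2l; first by apply: exprn_ge0; exact: mulr_ge0.
  apply: ler_wpM2l; first by apply: exprn_ge0; exact: ltW.
  apply: le_trans (expect_sqr_diff_le _ p01' h01) _.
  apply: ler_wpM2l; first exact: exprn_ge0.
  rewrite (bigD1 J) //= lerD //.
    apply: expect_le => // F _; rewrite (_ : F :\: J :|: J = F :|: J) //.
    by apply/setP => d; rewrite !inE; case: (d \in J); rewrite ?orbT ?orbF.
  rewrite -sum_subset_const [leRHS](bigD1 J) //= -[leLHS]add0r lerD //.
    by apply: mulr_ge0 => //; apply: exprn_ge0.
  apply: ler_sum => U /andP[UJ nUJ].
  have pU : U \proper J by rewrite properEneq nUJ.
  apply: (expect_infl_sdr_le p02 kappaP cJ UJ (implyP (minJ U) pU)).
  exact: ltn_trans (proper_card pU) ltJ.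
rewrite -(expect_setU p h (subsetT J)).
set X := expect _ _ _.
have X0 : 0 <= X by apply: expect_ge0 => // F _; case/andP: (h01 (F :|: J)).
move: #|J| X X0 => m X X0.
have -> : (8 * t) ^+ m * (p ^+ m * (2 ^+ m * (X + 2 ^+ m * (2 ^+ m.+1 * kappa)))) =
   2 * kappa * ((8 * t) ^+ m * p ^+ m * 2 ^+ m * 2 ^+ m * 2 ^+ m) + (8 * t) ^+ m * 2 ^+ m * (p ^+ m * X).
  by rewrite [2 ^+ m.+1]exprS; ring.
rewrite -!exprMn; apply: lerD.
  by rewrite (_ : 8 * t * p * 2 * 2 * 2 = 64 * t * p) //; ring.
apply: ler_wpM2r; first by apply: mulr_ge0 => //; apply: exprn_ge0; exact: ltW.
by apply: lerXn2r; rewrite ?nnegrE; have := t0; lra.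
Qed.

(** Minimal obstructions are split by density. Those with [J] dense use [min_bad_term_le]; for those
    with only [c |: J] dense the crude bound 4^|J| suffices, such sets being rare once [c] is summed
    too. *)
Lemma fourth_moment_infl :
  Ex p (fun F => noise p r [set: C] (noise p (1 / 2) [set: C] h) F ^+ 4) <=
  ((1 / 2) ^+ r0 + 2 * kappa) * Ex p h +
  2 * kappa * (\sum_(J : {set C} | dense J) (64 * t * p) ^+ #|J|) +
  (\sum_(J : {set C} | dense J && (c \notin J))
    (64 * t) ^+ #|J| * Ex p (fun F => (J \subset F)%:R * h F)) +
  \sum_(J : {set C} | (c \notin J) && dense (c |: J)) (32 * t * p) ^+ #|J|.
Proof.
have eps0 : 0 <= (1 / 2) ^+ r0 + 2 * kappa.
  by rewrite addr_ge0 ?mulr_ge0 // exprn_ge0 //; lra.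
have t8 : 8 * t <= 1 by have := t0; have := t64; lra.
have r02 : 0 <= r <= 1 / 2 by rewrite r_ge0.
apply: le_trans (noise_fourth_moment_le p01 p2 r02 t8 eps0 h01 cover_min_bad) _.
rewrite -!addrA; apply: lerD.
  rewrite le_eqVlt; apply/orP; left; apply/eqP; congr (_ * _); apply: expect_eq => F _.
  by rewrite /h; case: (infl_unsat01 c set0 F) => ->; rewrite ?expr0n ?expr1n.
have hJ0 J : 0 <= Ex p (fun F => (J \subset F)%:R * h F).
  by apply: expect_ge0 => // F _; apply: mulr_ge0; [exact: ler0n | case/andP: (h01 F)].
have t64p : 0 <= 64 * t * p by apply: mulr_ge0 (ltW p0); exact: mulr_ge0.
have t32p : 0 <= 32 * t * p by apply: mulr_ge0 (ltW p0); exact: mulr_ge0.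
have t640 : 0 <= 64 * t by exact: mulr_ge0.
rewrite mulr_sumr big_mkcond [X in _ <= X + _]big_mkcond.
rewrite [X in _ <= _ + (X + _)]big_mkcond [X in _ <= _ + (_ + X)]big_mkcond -!big_split.
apply: ler_sum => J _ /=.
have k0 : 0 <= 2 * kappa * (64 * t * p) ^+ #|J| by rewrite !mulr_ge0 // exprn_ge0.
have e0 : 0 <= (64 * t) ^+ #|J| * Ex p (fun F => (J \subset F)%:R * h F).
  by rewrite mulr_ge0 // exprn_ge0.
have d0 : 0 <= (32 * t * p) ^+ #|J| by rewrite exprn_ge0.
case: ifP => [bJ|_]; last by rewrite !addr_ge0 //; case: ifP.
have cJ : c \notin J by case/and4P: bJ.
rewrite cJ andbT /=; have := min_bad_dense bJ; have [dJ _|_ /= ->] := boolP (dense J).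
  apply: le_trans (min_bad_term_le bJ) _; rewrite addrA lerDl.
  by case: ifP.
rewrite !add0r; apply: le_trans (_ : (8 * t) ^+ #|J| * (p ^+ #|J| * 4 ^+ #|J|) <= _).
  apply: ler_wpM2l; first by apply: exprn_ge0; exact: mulr_ge0.
  apply: le_trans (v_le J) _; apply: ler_wpM2l; first by apply: exprn_ge0; exact: ltW.
  exact: expect_sqr_diff_le4.
rewrite -!exprMn (_ : 8 * t * (p * 4) = 32 * t * p) //; ring.
Qed.

End Classify.
End Pivotal.

(** * The variance bound and the effect of forbidding literals *)

Section Assemble.
Variables (R : realType) (n q k : nat).
Local Notation C := (constraint n q k).
Local Notation L := ('I_n * 'I_q)%type.
Local Notation Ex p := (expect p [set: C]).
Local Notation unsat := (@unsat n q k R).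
Implicit Types (p : R) (c d : C) (F G J K U : {set C}) (s D : {set L}).

Lemma dense_card_gt0 J : dense J -> (0 < #|J|)%N.
Proof. exact: leq_ltn_trans. Qed.

(** A set K arises as [c |: J] in |K| <= 2^|K| ways, and the outer [p] supplies the weight of
    [c]. *)
Lemma sum_dense_setU1_le (p x : R) : 0 <= p -> 0 < x ->
  p * (\sum_c \sum_(J : {set C} | (c \notin J) && dense (c |: J)) (x * p) ^+ #|J|) <=
  x^-1 * \sum_(J : {set C} | dense J) (2 * x * p) ^+ #|J|.
Proof.
move=> p0 x0; pose G J := (dense J)%:R * (p * (x * p) ^+ #|J|.-1) : R.
have -> : p * (\sum_c \sum_(J : {set C} | (c \notin J) && dense (c |: J)) (x * p) ^+ #|J|) =
    \sum_c \sum_(J : {set C} | c \notin J) G (c |: J).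
  rewrite mulr_sumr; apply: eq_bigr => c _; rewrite big_mkcondr /= mulr_sumr.
  apply: eq_bigr => J cJ; rewrite /G cardsU1 cJ /=.
  by case: ifP => _; rewrite ?mul1r ?mul0r ?mulr0.
rewrite sum_setU1_notin mulr_sumr [leRHS]big_mkcond; apply: ler_sum => J _.
rewrite /G; case: ifP => [dJ|_]; last by rewrite mul0r mulr0.
rewrite mul1r; have := dense_card_gt0 dJ; case: #|J| => // m _.
have -> : m.+1%:R * (p * (x * p) ^+ m) = x^-1 * (m.+1%:R * (x * p) ^+ m.+1).
  by rewrite [in RHS]exprS; field; rewrite gt_eqF.
rewrite ler_wpM2l ?invr_ge0 ?(ltW x0) // -mulrA [leRHS]exprMn ler_wpM2r //.
  by rewrite exprn_ge0 // mulr_ge0 // ltW.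
by rewrite -natrX ler_nat ltnW // ltn_expl.
Qed.

(** This is [variance_le] with rho = r/2 and the noisy correlations cut at [alpha]. The four terms
    multiplied by [alpha ^- 3] are the four terms of [fourth_moment_infl] summed over [c]. *)
Lemma unsat_variance_le (p r alpha kappa D : R) (r0 d : nat) :
  0 < p -> p <= 1 / 2 -> 0 < r -> r <= 1 / 2 -> 64 * (3 * r ^+ 4) <= 1 -> (0 < n)%N ->
  (0 < d)%N -> 0 < alpha ->
  (forall s, functional s -> (#|s| <= r0)%N ->
    Ex p (unsat s) - Ex p (unsat set0) <= kappa) ->
  \sum_c Ex p (infl c (unsat set0)) <= D ->
  \sum_c \sum_(J : {set C} | dense J && (c \notin J)) (64 * (3 * r ^+ 4)) ^+ #|J| *
     Ex p (fun F => (J \subset F)%:R * infl c (unsat set0) F) <= D / n%:R ->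
  \sum_(J : {set C} | dense J) (64 * (3 * r ^+ 4) * p) ^+ #|J| <= n%:R^-1 ->
  Ex p (unsat set0) - Ex p (unsat set0) ^+ 2 <=
  d%:R^-1 * (p * D) + (r / 2) ^- d * (alpha * (p * D) + alpha ^- 3 *
    (((1 / 2) ^+ r0 + 2 * kappa) * (p * D) + 2 * kappa * (p * #|C|%:R / n%:R) +
      p * D / n%:R + (32 * (3 * r ^+ 4))^-1 / n%:R)).
Proof.
move=> p0 p2 r_gt0 r_le t64 n0 d0 al0 kappaP H1 H2 H3.
set t := 3 * r ^+ 4 in t64 H2 H3 *.
have t_gt0 : 0 < t by rewrite /t mulr_gt0 // exprn_gt0.
have p01 : 0 <= p <= 1 by rewrite (ltW p0) /=; lra.
have kappa0 : 0 <= kappa.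
  by have := kappaP _ (@functional0 n q); rewrite cards0 subrr; apply.
have al3 : 0 < alpha ^- 3 by rewrite invr_gt0 exprn_gt0.
have rho0 : 0 < r / 2 by rewrite divr_gt0.
have rhod0 : 0 < (r / 2) ^- d by rewrite invr_gt0 exprn_gt0.
have D0 : 0 <= D.
  by apply: le_trans H1; apply: sumr_ge0 => c _; apply: expect_ge0 => // F _;
    exact/infl_ge0/monotone_unsat.
have vp : p * (1 - p) <= p by rewrite ler_piMr ?(ltW p0) //; lra.
have sq (f : {set C} -> R) : (forall F, f F = 0 \/ f F = 1) ->
    Ex p (fun F => f F ^+ 2) = Ex p f.
  by move=> f01; apply: expect_eq => F _; case: (f01 F) => ->; rewrite ?expr0n ?expr1n.
have f01 F : unsat set0 F = 0 \/ unsat set0 F = 1.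
  by rewrite /unsat; case: satisfiable; [left|right].
have := @variance_le _ _ p r (1 / 2) (unsat set0) d p01.
rewrite (sq _ f01) (_ : r * (1 / 2) = r / 2) => [|]; last by rewrite mulrA mulr1.
move=> /(_ _ d0).
have -> : 0 < r / 2 <= 1 by rewrite rho0 /=; lra.
move=> /(_ isT) /le_trans; apply; apply: lerD.
  rewrite ler_wpM2l ?invr_ge0 ?ler0n //; apply: ler_pM => //.
  - by apply: mulr_ge0; lra.
  - by apply: sumr_ge0 => c _; apply: expect_ge0 => // F _; apply: sqr_ge0.
  apply: le_trans H1; rewrite le_eqVlt; apply/orP; left; apply/eqP.
  by apply: eq_bigr => c _; rewrite sq // => F; exact: infl_unsat01.
rewrite ler_wpM2l ?(ltW rhod0) //.
set E4 := fun c => Ex p (fun F =>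
  noise p r [set: C] (noise p (1 / 2) [set: C] (infl c (unsat set0))) F ^+ 4).
have E40 c : 0 <= E4 c.
  by apply: expect_ge0 => // F _; rewrite (exprM _ 2 2) sqr_ge0.
have nu0 c : 0 <= Ex p (infl c (unsat set0)).
  by apply: expect_ge0 => // F _; exact/infl_ge0/monotone_unsat.
apply: le_trans (_ : p * (1 - p) * \sum_c (alpha * Ex p (infl c (unsat set0)) + alpha ^- 3 * E4 c) <= _).
  apply: ler_wpM2l; first by apply: mulr_ge0; lra.
  apply: ler_sum => c _; apply: expect_indicator_mul_le => // F.
  exact: infl_unsat01.
apply: le_trans (_ : p * \sum_c (alpha * Ex p (infl c (unsat set0)) + alpha ^- 3 * E4 c) <= _).
  apply: ler_wpM2r => //; apply: sumr_ge0 => c _.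
  by apply: addr_ge0; apply: mulr_ge0 => //; exact: ltW.
rewrite big_split -!mulr_sumr mulrDr /=; apply: lerD.
  by rewrite mulrCA ler_wpM2l ?(ltW al0) // ler_wpM2l // ltW.
rewrite mulrCA ler_wpM2l ?(ltW al3) //.
set S := \sum_(J : {set C} | dense J) _ in H3.
have S0 : 0 <= S.
  apply: sumr_ge0 => J _; apply: exprn_ge0; apply: mulr_ge0; last exact: ltW.
  by apply: mulr_ge0 => //; exact: ltW.
have eps0 : 0 <= (1 / 2) ^+ r0 + 2 * kappa.
  by rewrite addr_ge0 ?mulr_ge0 // exprn_ge0 //; lra.
apply: le_trans (_ : p * (((1 / 2) ^+ r0 + 2 * kappa) * (\sum_c Ex p (infl c (unsat set0))) +
   #|C|%:R * (2 * kappa * S) +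
   (\sum_c \sum_(J : {set C} | dense J && (c \notin J)) (64 * t) ^+ #|J| *
     Ex p (fun F => (J \subset F)%:R * infl c (unsat set0) F)) +
   \sum_c \sum_(J : {set C} | (c \notin J) && dense (c |: J)) (32 * t * p) ^+ #|J|) <= _).
  apply: ler_wpM2l; first exact: ltW.
  have -> : #|C|%:R * (2 * kappa * S) = \sum_(c : C) 2 * kappa * S.
    by rewrite sumr_const -[RHS]mulr_natl.
  rewrite [_ * \sum_c _]mulr_sumr -!big_split; apply: ler_sum => c _ /=.
  exact: (fourth_moment_infl c p0 p2 (ltW r_gt0) r_le t64 n0 kappaP).
rewrite !mulrDr; apply: lerD; [apply: lerD; [apply: lerD|]|].
- by rewrite mulrCA ler_wpM2l // ler_wpM2l // ltW.
- have -> : p * (#|C|%:R * (2 * kappa * S)) = 2 * kappa * (p * #|C|%:R) * S by ring.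
  have -> : 2 * kappa * (p * #|C|%:R / n%:R) = 2 * kappa * (p * #|C|%:R) * n%:R^-1 by ring.
  by apply: ler_wpM2l => //; rewrite !mulr_ge0 ?ler0n // ltW.
- by rewrite -mulrA ler_wpM2l // ltW.
have x0 : 0 < 32 * t by rewrite mulr_gt0.
apply: le_trans (sum_dense_setU1_le (ltW p0) x0) _.
apply: ler_wpM2l; first by rewrite invr_ge0 ltW.
apply: le_trans H3; rewrite le_eqVlt; apply/orP; left; apply/eqP.
by apply: eq_bigr => J _; congr (_ ^+ _); ring.
Qed.

(** By Russo's formula the total influence is the derivative in [p] of a function depending only on
    the number of forbidden literals. *)
Lemma sum_infl_unsat_card p s D : functional s -> functional D -> #|s| = #|D| ->
  \sum_c Ex p (infl c (unsat s)) = \sum_c Ex p (infl c (unsat D)).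
Proof.
move=> fs fD cs.
have E : (fun x : R => Ex x (unsat s)) = (fun x => Ex x (unsat D)).
  by apply/funext => x; apply: expect_unsat_card.
have Hs := russo p [set: C] (unsat s); have HD := russo p [set: C] (unsat D).
rewrite -E in HD; have := @derive_val _ _ _ _ _ _ _ Hs.
rewrite (@derive_val _ _ _ _ _ _ _ HD).
have sumT (g : C -> R) : \sum_(c in [set: C]) g c = \sum_c g c.
  by apply: eq_bigl => c; rewrite in_setT.
by rewrite !sumT.
Qed.

(** The increments are telescoped over the literals of [s]; influences need control only at one
    reference set [sj j] per size. *)
Lemma unsat_literals_le p (B r0 : nat) (D1 : R) (sj : nat -> {set L}) :
  0 <= p <= 1 -> (0 < q)%N -> (k <= B)%N -> (r0 < n)%N ->
  (forall j, (j < r0)%N -> functional (sj j) /\ #|sj j| = j) ->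
  (forall j, (j < r0)%N -> \sum_c Ex p (infl c (unsat (sj j))) <= D1) ->
  forall s, functional s -> (#|s| <= r0)%N ->
  Ex p (unsat s) - Ex p (unsat set0) <=
    #|s|%:R * ((B%:R + n%:R / 'C(B, k)%:R * D1) / ((n - r0) * q)%:R).
Proof.
move=> p01 q0 kB rn sjP sjD.
set delta := (_ / ((n - r0) * q)%:R).
move=> s; have [m] := ubnP #|s|; elim: m s => // m IHm s ltm fs sr.
have [->|[l ls]] := set_0Vmem s; first by rewrite cards0 mul0r subrr.
have sE : #|s| = #|s :\ l|.+1 by rewrite (cardsD1 l s) ls.
have fs' : functional (s :\ l) by apply: functional_sub fs; apply: subD1set.
have ll : l.1 \notin lvars (s :\ l).
  apply/imsetP => -[x]; rewrite !inE => /andP[xl xs] e.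
  by case/negP: xl; apply/eqP; apply: fs.
have lt' : (#|s :\ l| < r0)%N by rewrite -sE.
have IH : Ex p (unsat (s :\ l)) - Ex p (unsat set0) <= #|s :\ l|%:R * delta.
  by apply: IHm => //; [rewrite -ltnS -sE | exact: ltnW].
have [fj cj] := sjP _ lt'.
have D1j : \sum_c Ex p (infl c (unsat (s :\ l))) <= D1.
  by rewrite (sum_infl_unsat_card p fs' fj) ?cj // sjD.
have incr := unsat_increment_le p01 fs' ll kB; rewrite setD1K // in incr.
have W0 : (0 : R) < ((n - r0) * q)%:R by rewrite ltr0n muln_gt0 subn_gt0 rn.
have inc0 : 0 <= Ex p (unsat s) - Ex p (unsat (s :\ l)).
  rewrite subr_ge0; apply: expect_le => // F _.
  by apply: unsat_sub => //; apply: subD1set.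
have : Ex p (unsat s) - Ex p (unsat (s :\ l)) <= delta.
  rewrite /delta ler_pdivlMr // mulrC.
  apply: le_trans (_ : ((n - #|s :\ l|) * q)%:R * (Ex p (unsat s) - Ex p (unsat (s :\ l))) <= _).
    by apply: ler_wpM2r => //; rewrite ler_nat leq_mul2r leq_sub2l ?orbT // ltnW.
  apply: le_trans incr _; rewrite lerD2l ler_wpM2l // divr_ge0 ?ler0n //.
rewrite sE -natr1 mulrDl mul1r; lra.
Qed.

End Assemble.

(** * Counting sets with more constraints than variables *)

Section Counting.
Variable R : realType.

Lemma sum_subset_expr (T : finType) (x : R) (A : {set T}) :
  \sum_(J : {set T} | J \subset A) x ^+ #|J| = (1 + x) ^+ #|A|.
Proof.
elim/setU1_ind: A => [|y A yA IH].
  rewrite (big_pred1 set0) => [|J]; last by rewrite subset0.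
  by rewrite !cards0 !expr0.
rewrite sum_subsetU1 // cardsU1 yA exprS -IH mulr_sumr; apply: eq_bigr => J sJ.
by rewrite cardsU1 (notin_subset yA sJ) add1n exprS; ring.
Qed.

(** Falling factorials are compared factor by factor: (m - i) n <= (n - i) m. *)
Lemma bin_expn_le (m n k : nat) : (m <= n)%N -> ('C(m, k) * n ^ k <= 'C(n, k) * m ^ k)%N.
Proof.
move=> mn; rewrite -(leq_pmul2r (fact_gt0 k)) mulnAC bin_ffact [leqRHS]mulnAC bin_ffact.
elim: k => [|k IH]; first by rewrite !ffactn0.
rewrite !ffactnSr !expnSr mulnACA [leqRHS]mulnACA; apply: leq_mul => //.
by rewrite !mulnBl mulnC leq_sub2l // leq_mul2l mn orbT.
Qed.

(** The left side is one term in the expansion of (1 + m/n)^n. *)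
Lemma bin_expr_le (n m : nat) : (0 < n)%N ->
  'C(n, m)%:R * (m%:R / n%:R) ^+ m <= expR 1 ^+ m :> R.
Proof.
move=> n0; set x := m%:R / n%:R; have x0 : 0 <= x by rewrite divr_ge0.
apply: le_trans (_ : (1 + x) ^+ n <= _).
  have := sum_subset_expr x [set: 'I_n]; rewrite cardsT card_ord => <-.
  rewrite (bigID (fun J : {set 'I_n} => #|J| == m)) /= -[leLHS]addr0 lerD //; last first.
    by apply: sumr_ge0 => J _; apply: exprn_ge0.
  rewrite (eq_bigr (fun=> x ^+ m)) => [|J /andP[_ /eqP-> //]].
  rewrite sumr_const -[leRHS]mulr_natl ler_wpM2r ?exprn_ge0 // ler_nat.
  have -> : 'C(n, m) = #|[set J : {set 'I_n} | #|J| == m]| by rewrite card_draws card_ord.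
  by apply: subset_leq_card; apply/subsetP => J; rewrite inE => Jm; rewrite unfold_in subsetT.
apply: le_trans (_ : expR x ^+ n <= _).
  by apply: lerXn2r; rewrite ?nnegrE ?expR_ge0 ?expR_ge1Dx ?addr_ge0.
rewrite -expRM_natl -expRM_natl mulr1 (_ : n%:R * x = m%:R) // mulrC divfK //.
by rewrite pnatr_eq0 -lt0n.
Qed.

Variables (n q k : nat).
Local Notation C := (constraint n q k).

Lemma card_vars_subset (U : {set 'I_n}) :
  #|[set c : C | vars c \subset U]| = (q ^ k * 'C(#|U|, k))%N.
Proof.
rewrite -sum1_card big_mkcond /=.
under eq_bigr do rewrite inE /vars.
pose F (S : scope n k) (a : {ffun {i : 'I_n | i \in val S} -> 'I_q}) :=
  if val S \subset U then 1%N else 0%N.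
transitivity (\sum_(S : scope n k) \sum_(a : {ffun {i : 'I_n | i \in val S} -> 'I_q}) F S a)%N.
  by rewrite sig_big_dep; apply: eq_bigr => -[].
rewrite /F (eq_bigr (fun S : scope n k => if val S \subset U then (q ^ k)%N else 0%N)); last first.
  move=> S _; rewrite sum_nat_const card_ffun card_sig card_ord (eqP (valP S)).
  by case: ifP; rewrite ?muln1 ?muln0.
rewrite -big_mkcond sum_nat_const mulnC; congr (_ * _)%N.
rewrite -cards_draws -(card_imset _ val_inj); apply: eq_card => D; rewrite inE.
apply/imsetP/andP => [[S]|[sD cD]]; first by rewrite unfold_in => sS ->; rewrite sS (valP S).
by exists (exist _ D cD).
Qed.

Let E : R := expR 1.

(** A union bound over the set [U] of variables of [J]: with v variables there are at least v + 1
    constraints. The surplus constraint is what yields the factor 1/n. *)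
Lemma dense_sum_le (p theta C2 : R) :
  0 <= p -> (2 <= k)%N -> p * (q ^ k * 'C(n, k))%:R <= C2 * n%:R ->
  0 < theta -> theta * C2 <= (4 * E ^+ 2)^-1 ->
  \sum_(J : {set C} | dense J) (theta * p) ^+ #|J| <= n%:R^-1.
Proof.
set beta := (4 * E ^+ 2)^-1 => p0 k2 pN th0 thC.
have E1 : 1 <= E by apply: le_trans (expR_ge1Dx 1); lra.
have E0 : 0 < E by exact: expR_gt0.
have beta0 : 0 < beta by rewrite invr_gt0 mulr_gt0 // exprn_gt0.
have betaE : beta * E ^+ 2 = 1 / 4.
  by rewrite /beta; field; rewrite gt_eqF.
have beta1 : beta <= 1.
  by rewrite invf_le1 ?mulr_gt0 ?exprn_gt0 //; have : 1 <= E ^+ 2 by [exact: exprn_ege1]; lra.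
have x0 : 0 <= theta * p by rewrite mulr_ge0 // ltW.
pose W (U : {set 'I_n}) := [set c : C | vars c \subset U].
pose G (v : nat) : R := (beta * (v%:R / n%:R)) ^+ v.+1 * E ^+ v.
have G0 v : 0 <= G v.
  by rewrite mulr_ge0 ?exprn_ge0 ?(ltW E0) // mulr_ge0 ?(ltW beta0) // divr_ge0.
apply: le_trans (_ : \sum_(U : {set 'I_n} | U != set0)
   \sum_(J : {set C} | (J \subset W U) && (#|U| < #|J|)%N) (theta * p) ^+ #|J| <= _).
  rewrite (exchange_big_dep predT) //= [leLHS]big_mkcond; apply: ler_sum => J _.
  case: ifP => [dJ|_]; last by apply: sumr_ge0 => U _; apply: exprn_ge0.
  rewrite (bigD1 (nbhd (@vars n q k) J)) /=.
    by rewrite -[leLHS]addr0 lerD // sumr_ge0 // => U _; apply: exprn_ge0.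
  apply/and3P; split.
  - have /card_gt0P[c cJ] := dense_card_gt0 dJ.
    have : (0 < #|vars c|)%N by rewrite card_vars ltnW.
    move=> /card_gt0P[i ic]; apply/set0Pn; exists i; apply/bigcupP; by exists c.
  - apply/subsetP => c cJ; rewrite inE; exact: bigcup_sup.
  - exact: dJ.
have inner (U : {set 'I_n}) : U != set0 ->
  \sum_(J : {set C} | (J \subset W U) && (#|U| < #|J|)%N) (theta * p) ^+ #|J| <= G #|U|.
  rewrite -card_gt0; move Ev : #|U| => v v0.
  have vn : (v <= n)%N by rewrite -Ev -[n in (_ <= n)%N]card_ord max_card.
  have n0 : (0 < n)%N by apply: leq_trans vn.
  have vR : 0 < v%:R :> R by rewrite ltr0n.
  have nR : 0 < n%:R :> R by rewrite ltr0n.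
  set y := beta * (v%:R / n%:R).
  have y0 : 0 < y by rewrite mulr_gt0 // divr_gt0.
  have y1 : y <= 1.
    rewrite -[leRHS]mulr1; apply: ler_pM; rewrite ?(ltW beta0) ?divr_ge0 //.
    by rewrite ler_pdivrMr // mul1r ler_nat.
  have lam1 : 1 <= y^-1 by rewrite invf_ge1.
  (* An exponential Markov bound: for |J| > v and y <= 1, one has 1 <= y^(v+1) y^-|J|. *)
  apply: le_trans (_ : y ^+ v.+1 * \sum_(J : {set C} | J \subset W U) (y^-1 * (theta * p)) ^+ #|J| <= _).
    rewrite mulr_sumr big_mkcondr /=; apply: ler_sum => J _.
    case: ifP => [vJ|_]; last first.
      by rewrite mulr_ge0 // exprn_ge0 ?(ltW y0) // mulr_ge0 // invr_ge0 ltW.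
    rewrite [(y^-1 * _) ^+ _]exprMn mulrA -[leLHS]mul1r ler_wpM2r ?exprn_ge0 //.
    rewrite exprVn ler_pdivlMr ?exprn_gt0 // mul1r.
    by apply: ler_wiXn2l => //; exact: ltW.
  rewrite sum_subset_expr /G; apply: ler_wpM2l; first by rewrite exprn_ge0 // ltW.
  have z0 : 0 <= y^-1 * (theta * p) by rewrite mulr_ge0 // invr_ge0 ltW.
  apply: le_trans (_ : expR (y^-1 * (theta * p)) ^+ #|W U| <= _).
    by apply: lerXn2r; rewrite ?nnegrE ?expR_ge0 ?expR_ge1Dx ?addr_ge0.
  rewrite -expRM_natl /E -expRM_natl mulr1 ler_expR card_vars_subset Ev.
  (* As k >= 2, the power (v/n)^k is at most (v/n)^2; this brings the exponent down to at most v. *)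
  have B1 : p * (q ^ k * 'C(v, k))%:R <= C2 * n%:R * (v%:R / n%:R) ^+ 2.
    apply: le_trans (_ : p * (q ^ k * 'C(n, k))%:R * (v%:R / n%:R) ^+ k <= _).
      rewrite -mulrA; apply: ler_wpM2l => //.
      rewrite expr_div_n mulrA ler_pdivlMr ?exprn_gt0 // -!natrX -!natrM ler_nat.
      by rewrite -!mulnA leq_mul2l bin_expn_le ?orbT.
    apply: ler_pM => //; rewrite ?mulr_ge0 ?exprn_ge0 ?divr_ge0 //.
    apply: ler_wiXn2l => //.
    by rewrite ler_pdivrMr // mul1r ler_nat.
  have -> : (q ^ k * 'C(v, k))%:R * (y^-1 * (theta * p)) =
      y^-1 * theta * (p * (q ^ k * 'C(v, k))%:R) by ring.
  apply: le_trans (_ : y^-1 * theta * (C2 * n%:R * (v%:R / n%:R) ^+ 2) <= _).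
    by apply: ler_wpM2l => //; rewrite mulr_ge0 ?invr_ge0 ?(ltW y0) // ltW.
  have -> : y^-1 * theta * (C2 * n%:R * (v%:R / n%:R) ^+ 2) = theta * C2 / beta * v%:R.
    by rewrite /y; field; rewrite ?gt_eqF.
  by rewrite ler_piMl ?(ltW vR) // ler_pdivrMr // mul1r.
apply: le_trans (ler_sum _ inner) _.
rewrite (partition_big (fun U : {set 'I_n} => inord #|U| : 'I_n.+1) predT) //=.
have [n0|n0] := posnP n.
  rewrite big1 ?invr_ge0 // => v _; rewrite big1 // => U /andP[].
  have : (#|U| <= n)%N by rewrite -[n in (_ <= n)%N]card_ord max_card.
  by rewrite -card_gt0; lia.
have nR : 0 < n%:R :> R by rewrite ltr0n.
apply: le_trans (_ : \sum_(v < n.+1) (if v == 0 :> nat then 0 else n%:R^-1 * (1 / 2) ^+ v) <= _).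
  apply: ler_sum => v _.
  apply: le_trans (_ : \sum_(U : {set 'I_n} | (U != set0) && (#|U| == v)) G v <= _).
    rewrite le_eqVlt; apply/orP; left; apply/eqP; apply: eq_big => [U|U /andP[_ /eqP <-]].
      congr (_ && _); apply/eqP/eqP => [<-|->]; last exact: inord_val.
      by rewrite inordK // ltnS -[n in (_ <= n)%N]card_ord max_card.
    by rewrite inordK // ltnS -[n in (_ <= n)%N]card_ord max_card.
  case: ifP => [/eqP v0|/negbT v0].
    rewrite big1 // => U /andP[]; rewrite -card_gt0 => + /eqP Ue.
    by rewrite Ue v0.
  apply: le_trans (_ : 'C(n, v)%:R * G v <= _).
    rewrite sumr_const -[leLHS]mulr_natl ler_wpM2r // ler_nat.
    have -> : 'C(n, v) = #|[set J : {set 'I_n} | #|J| == v]| by rewrite card_draws card_ord.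
    by apply: subset_leq_card; apply/subsetP => J; rewrite unfold_in inE => /andP[].
  (* The binomial coefficient uses up v of the v + 1 powers of v/n; there remains beta (v/n) (beta
     e^2)^v, with beta e^2 = 1/4. *)
  have -> : 'C(n, v)%:R * G v =
     ('C(n, v)%:R * (v%:R / n%:R) ^+ v) * (beta * (v%:R / n%:R) * (beta * E) ^+ v).
    by rewrite /G exprS !exprMn; ring.
  apply: le_trans (ler_wpM2r _ (bin_expr_le v n0)) _.
    apply: mulr_ge0; last by apply/exprn_ge0/mulr_ge0; exact: ltW.
    by apply: mulr_ge0; [exact: ltW | exact: divr_ge0].
  have -> : expR 1 ^+ v * (beta * (v%:R / n%:R) * (beta * E) ^+ v) =
      beta * n%:R^-1 * (v%:R * (beta * E ^+ 2) ^+ v).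
    have -> : (beta * E ^+ 2) ^+ v = beta ^+ v * (E ^+ v * E ^+ v).
      by rewrite exprMn -exprM mul2n -addnn exprD.
    by rewrite -/E exprMn; ring.
  rewrite betaE -[n%:R^-1 * (1 / 2) ^+ v]mul1r -mulrA; apply: ler_pM => //.
    exact: ltW.
  apply: ler_wpM2l; first by rewrite invr_ge0.
  have -> : (1 / 4 : R) = (1 / 2) * (1 / 2) by field.
  rewrite exprMn mulrA -[leRHS]mul1r; apply: ler_wpM2r; first by rewrite exprn_ge0.
  rewrite expr_div_n expr1n mulrA mulr1 ler_pdivrMr ?exprn_gt0 // mul1r -natrX ler_nat.
  by rewrite ltnW // ltn_expl.
rewrite big_ord_recl /= add0r -mulr_sumr; apply: ler_piMr; first by rewrite invr_ge0.
have -> : \sum_(i < n) (1 / 2) ^+ bump 0 i = 1 - (1 / 2) ^+ n :> R.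
  elim: (n) => [|m IH]; first by rewrite big_ord0 subrr.
  by rewrite big_ord_recr /= IH /bump /= add1n exprS; field.
by rewrite gerBl exprn_ge0.
Qed.

End Counting.

(** * The threshold window *)

Section Threshold.
Variables (R : realType) (n q k : nat).
Local Notation C := (constraint n q k).
Local Notation L := ('I_n * 'I_q)%type.
Local Notation Ex p := (expect p [set: C]).
Local Notation unsat := (@unsat n q k R).
Implicit Types (p : R) (c d : C) (F G J K U : {set C}) (s D : {set L}).

(** The right side is the expected number of solutions: each assignment is forbidden by one
    constraint per scope. *)
Lemma first_moment p : 0 <= p <= 1 ->
  1 - Ex p (unsat set0) <= (q ^ n)%:R * (1 - p) ^+ 'C(n, k).
Proof.
move=> p01.
pose B (x : assignment n q) := [set c : C | lits c \subset graph x].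
have cB x : #|B x| = 'C(n, k).
  by rewrite (card_lits_subset k (@functional_graph _ _ x)) card_graph.
apply: le_trans (_ : Ex p (fun F => \sum_(x : assignment n q) [disjoint F & B x]%:R * 1) <= _).
  rewrite -(expect1 p [set: C]) -[X in X - _]mul1r -mulN1r -expect_lin.
  apply: expect_le => // F _; rewrite mul1r mulN1r expect1.
  have S0 : 0 <= \sum_(x : assignment n q) ([disjoint F & B x]%:R * 1 : R).
    by apply: sumr_ge0 => x _; rewrite mulr1.
  rewrite /unsat; have [st|_] := boolP (satisfiable F set0); last by rewrite subrr.
  rewrite subr0; have /satisfiableP[x [h _]] := st; rewrite (bigD1 x) //= -[leLHS]addr0 lerD //.
    rewrite mulr1 -[leLHS]/(true%:R) ler_nat lt0b -setI_eq0; apply/eqP/setP => c.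
    by rewrite !inE; apply/negbTE/negP => /andP[/h/negP].
  by apply: sumr_ge0 => y _; rewrite mulr1.
rewrite expect_sum (eq_bigr (fun=> (1 - p) ^+ 'C(n, k))) => [|x _].
  by rewrite sumr_const card_ffun !card_ord -[leLHS]mulr_natl.
by rewrite -expect_setD ?subsetT // cB expect1 mulr1.
Qed.

Section Select.
Variables (a b theta : R) (r0 : nat) (sj : nat -> {set L}).
Hypotheses (a0 : 0 <= a) (ab : a < b) (b1 : b <= 1) (theta0 : 0 <= theta).
Hypotheses (n0 : (0 < n)%N) (r0_gt0 : (0 < r0)%N).
Hypothesis sparse : \sum_(J : {set C} | dense J) (theta * b) ^+ #|J| <= n%:R^-1.
Let D : R := 3 / (b - a).

Let X F : R := \sum_(J : {set C} | dense J) theta ^+ #|J| * (J \subset F)%:R.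

Let X_ge0 F : 0 <= X F.
Proof. by apply: sumr_ge0 => J _; rewrite mulr_ge0 ?exprn_ge0. Qed.

Let X_sub F G : F \subset G -> X F <= X G.
Proof.
move=> FG; apply: ler_sum => J _; rewrite ler_wpM2l ?exprn_ge0 // ler_nat.
by case JF: (J \subset F) => //; rewrite (subset_trans JF FG).
Qed.

Let XD1 c F : X (F :\ c) = \sum_(J : {set C} | dense J && (c \notin J)) theta ^+ #|J| * (J \subset F)%:R.
Proof.
rewrite /X big_mkcondr; apply: eq_bigr => J _; rewrite subsetD1.
by case: (c \in J); rewrite ?andbF ?andbT ?mulr0.
Qed.

(** One test function for all requirements: its influences dominate those of [unsat set0], the same
    weighted by dense sets, and the averaged ones with forbidden literals. The factor n is possible
    since [X] has mean at most 1/n at [b]. *)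
Let g F := (1 + n%:R * X F) * unsat set0 F + r0%:R^-1 * \sum_(j < r0) unsat (sj j) F.

(** A discrete product rule; the part due to the growth of [X] is nonnegative and dropped. *)
Let infl_g c F :
  infl c (unsat set0) F + n%:R * (X (F :\ c) * infl c (unsat set0) F) +
  r0%:R^-1 * \sum_(j < r0) infl c (unsat (sj j)) F <= infl c g F.
Proof.
rewrite /infl sumrB /g.
set u := unsat set0 _; set w := unsat set0 _.
set S1 := \sum_(j < r0) _; set S2 := \sum_(j < r0) _.
have u0 : 0 <= u by case/andP: (unsat01 R set0 (c |: F)).
have : X (F :\ c) <= X (c |: F).
  by apply: X_sub; rewrite (subset_trans (subD1set _ _)) // subsetUr.
move: (X (F :\ c)) (X (c |: F)) => x y xy.
have : 0 <= n%:R * ((y - x) * u).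
  by apply: mulr_ge0 => //; apply: mulr_ge0 => //; rewrite subr_ge0.
lra.
Qed.

(** The mean of [g] is nonnegative at [a] and at most 3 at [b], one unit for each of its pieces. The
    mean value theorem bounds its total influence by [D], hence each of the three nonnegative
    summands. *)
Lemma select_density : exists p, [/\ a < p < b,
  \sum_c Ex p (infl c (unsat set0)) <= D,
  \sum_c \sum_(J : {set C} | dense J && (c \notin J)) theta ^+ #|J| *
     Ex p (fun F => (J \subset F)%:R * infl c (unsat set0) F) <= D / n%:R &
  forall j, (j < r0)%N -> \sum_c Ex p (infl c (unsat (sj j))) <= r0%:R * D].
Proof.
have nR : 0 < n%:R :> R by rewrite ltr0n.
have rR : 0 < r0%:R :> R by rewrite ltr0n.
have b01 : 0 <= b <= 1 by rewrite (le_trans a0 (ltW ab)).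
have a01 : 0 <= a <= 1 by rewrite a0 (le_trans (ltW ab)).
have [p pab E] := expect_mvt [set: C] g ab.
have p01 : 0 <= p <= 1 by case/andP: pab => ? ?; lra.
have gb : Ex b g <= 3.
  apply: le_trans (_ : Ex b (fun F => n%:R * X F + 2 * 1) <= _).
    apply: expect_le => // F _; rewrite /g.
    have u1 : unsat set0 F <= 1 by case/andP: (unsat01 R set0 F).
    have S1 : \sum_(j < r0) unsat (sj j) F <= r0%:R.
      rewrite -[leRHS]/(1 *+ r0) -[r0 in leRHS]card_ord -sumr_const.
      by apply: ler_sum => j _; case/andP: (unsat01 R (sj j) F).
    have x0 : 0 <= 1 + n%:R * X F by rewrite addr_ge0 // mulr_ge0.
    have := ler_wpM2l x0 u1; have : r0%:R^-1 * \sum_(j < r0) unsat (sj j) F <= 1.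
      by rewrite mulrC ler_pdivrMr // mul1r.
    lra.
  rewrite expect_lin expect1.
  suff : n%:R * Ex b X <= 1 by lra.
  have EX : Ex b X = \sum_(J : {set C} | dense J) (theta * b) ^+ #|J|.
    rewrite /X expect_sum; apply: eq_bigr => J _; rewrite expectZ exprMn; congr (_ * _).
    have := expect_setU b (fun=> 1) (subsetT J); rewrite expect1 mulr1 => ->.
    by apply: expect_eq => F _; rewrite mulr1.
  by rewrite EX mulrC -ler_pdivlMr // div1r.
have ga : 0 <= Ex a g.
  apply: expect_ge0 => // F _; rewrite /g.
  have u0 s : 0 <= unsat s F by case/andP: (unsat01 R s F).
  by rewrite addr_ge0 // mulr_ge0 ?invr_ge0 ?sumr_ge0 // addr_ge0 // mulr_ge0.
have sumT (f : C -> R) : \sum_(c in [set: C]) f c = \sum_c f c.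
  by apply: eq_bigl => c; rewrite in_setT.
have gD : \sum_c Ex p (infl c g) <= D.
  by rewrite /D ler_pdivlMr ?subr_gt0 // -sumT -E; lra.
have infl0 s c F : 0 <= infl c (unsat s) F by exact/infl_ge0/monotone_unsat.
have E0 s c : 0 <= Ex p (infl c (unsat s)) by apply: expect_ge0.
pose Y c := Ex p (fun F => X (F :\ c) * infl c (unsat set0) F).
have Y0 c : 0 <= Y c by apply: expect_ge0 => // F _; rewrite mulr_ge0.
pose Z c := \sum_(j < r0) Ex p (infl c (unsat (sj j))).
have Z0 c : 0 <= Z c by apply: sumr_ge0.
have main : \sum_c Ex p (infl c (unsat set0)) + n%:R * (\sum_c Y c) + r0%:R^-1 * (\sum_c Z c) <= D.
  apply: le_trans gD; rewrite !mulr_sumr -!big_split; apply: ler_sum => c _ /=.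
  rewrite /Y /Z -!expectZ -expect_sum -expectZ -!expectD.
  by apply: expect_le => // F _; apply: infl_g.
have T1 : 0 <= \sum_c Ex p (infl c (unsat set0)) by apply: sumr_ge0.
have T2 : 0 <= n%:R * (\sum_c Y c) by rewrite mulr_ge0 // sumr_ge0.
have T3 : 0 <= r0%:R^-1 * (\sum_c Z c) by rewrite mulr_ge0 ?invr_ge0 // sumr_ge0.
exists p; split=> //; first lra.
  rewrite ler_pdivlMr // mulrC.
  suff -> : \sum_c \sum_(J : {set C} | dense J && (c \notin J)) theta ^+ #|J| *
     Ex p (fun F => (J \subset F)%:R * infl c (unsat set0) F) = \sum_c Y c by lra.
  apply: eq_bigr => c _; rewrite /Y.
  under eq_bigr do rewrite -expectZ.
  rewrite -expect_sum; apply: expect_eq => F _; rewrite XD1 mulr_suml.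
  by apply: eq_bigr => J _; rewrite mulrA.
move=> j jr; rewrite mulrC -ler_pdivrMr // mulrC.
apply: le_trans (_ : r0%:R^-1 * (\sum_c Z c) <= _); last lra.
rewrite ler_wpM2l ?invr_ge0 //; apply: ler_sum => c _.
by rewrite /Z (bigD1 (Ordinal jr)) //= -[leLHS]addr0 lerD // sumr_ge0.
Qed.

End Select.

Hypotheses (k_le : (k <= n)%N).

Local Notation thr := (@threshold R n q k).

Let mu1 : mu (1 : R) (Cover n q k) = 1.
Proof.
have := @first_moment 1; rewrite ler01 lexx => /(_ isT); rewrite subrr expr0n.
rewrite eqn0Ngt bin_gt0 k_le mulr0 mu_Cover => h; apply/eqP; rewrite eq_le.
apply/andP; split; last by lra.
have : Ex 1 (unsat set0) <= Ex 1 (fun=> 1).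
  apply: expect_le; first by rewrite ler01 lexx.
  by move=> F _; case/andP: (unsat01 R set0 F).
by rewrite expect1.
Qed.

Lemma threshold_le (alpha p : R) : 0 <= p <= 1 -> alpha <= Ex p (unsat set0) -> thr alpha <= p.
Proof.
move=> p01 h; apply: ge_inf; first by exists 0 => x [/andP[]].
by split=> //; rewrite mu_Cover.
Qed.

Lemma threshold_ge0 (alpha : R) : alpha <= 1 -> 0 <= thr alpha.
Proof.
move=> a1; apply: lb_le_inf; last by move=> x [/andP[]].
by exists 1; split; [rewrite ler01 lexx | rewrite mu1].
Qed.

Lemma lt_threshold (alpha p : R) : 0 <= p <= 1 -> p < thr alpha -> Ex p (unsat set0) < alpha.
Proof. by move=> p01; apply: contraTT; rewrite -!leNgt => /(threshold_le p01). Qed.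

Lemma gt_threshold (alpha p : R) : alpha <= 1 -> p <= 1 -> thr alpha < p ->
  alpha <= Ex p (unsat set0).
Proof.
move=> a1 p1 /inf_lt[]; first by exists 1; split; [rewrite ler01 lexx | rewrite mu1].
move=> x [/andP[x0 x1]]; rewrite mu_Cover => hx xp; apply: le_trans hx _.
by apply: expect_mono => //; [exact: ltW | exact: monotone_unsat].
Qed.

End Threshold.

(** * Bounds on the upper threshold and on the effect of forbidden literals *)

Section Window.
Variables (R : realType) (n q k : nat).
Local Notation C := (constraint n q k).
Local Notation L := ('I_n * 'I_q)%type.
Local Notation Ex p := (expect p [set: C]).
Local Notation unsat := (@unsat n q k R).
Local Notation N := ((q ^ k * 'C(n, k))%N).

Lemma card_constraint : #|C| = N.
Proof. exact: NconstraintsE. Qed.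

Lemma functional_family (j : nat) : (0 < q)%N -> (j <= n)%N ->
  exists s : {set L}, functional s /\ #|s| = j.
Proof.
move=> q0 jn; pose w (i : 'I_j) : L := (widen_ord jn i, Ordinal q0).
exists (w @: setT); split; last first.
  by rewrite card_imset ?cardsT ?card_ord // => i i' [] e; apply: val_inj.
by move=> _ _ /imsetP[i _ ->] /imsetP[i' _ ->] /= e; rewrite /w e.
Qed.

(** At [pm] the expected number of solutions is at most q^n exp(- pm 'C(n, k)) = eta^n <= eta. *)
Lemma threshold_upper (eta : R) : (2 <= q)%N -> (0 < n)%N -> (k <= n)%N ->
  0 < eta -> eta < 1 ->
  let pm := (q ^ k)%:R * (ln q%:R - ln eta) * n%:R / N%:R in
  pm <= 1 -> threshold n q k (1 - eta) <= pm.
Proof.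
move=> q2 n0 kn eta0 eta1 pm pm1.
have q0 : 0 < q%:R :> R by rewrite ltr0n; lia.
have qk0 : 0 < (q ^ k)%:R :> R by rewrite ltr0n expn_gt0; lia.
have b0 : 0 < 'C(n, k)%:R :> R by rewrite ltr0n bin_gt0.
have lnq : 0 <= ln q%:R :> R by rewrite ln_ge0 // ler1n; lia.
have lne : ln eta < 0 by rewrite ln_lt0 // eta0.
have pm0 : 0 <= pm.
  by rewrite /pm divr_ge0 // mulr_ge0 // mulr_ge0 ?(ltW qk0) //; lra.
apply: threshold_le; first by rewrite pm0.
have pm01 : 0 <= pm <= 1 by rewrite pm0.
have := first_moment n q k pm01.
suff : (q ^ n)%:R * (1 - pm) ^+ 'C(n, k) <= eta by lra.
apply: le_trans (_ : (q ^ n)%:R * expR (- pm) ^+ 'C(n, k) <= _).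
  rewrite ler_wpM2l //; apply: lerXn2r; rewrite ?nnegrE ?expR_ge0 ?subr_ge0 //.
  exact: expR_ge1Dx.
have -> : (q ^ n)%:R = expR (n%:R * ln q%:R) :> R.
  by rewrite expRM_natl lnK ?posrE // natrX.
rewrite -expRM_natl -expRD.
have -> : n%:R * ln q%:R + 'C(n, k)%:R * - pm = n%:R * ln eta.
  by rewrite /pm natrM; field; rewrite !gt_eqF.
rewrite -[leRHS](lnK (x := eta)) ?posrE // ler_expR.
rewrite -subr_ge0 (_ : ln eta - n%:R * ln eta = (n%:R - 1) * - ln eta); last by ring.
by rewrite mulr_ge0 ?subr_ge0 ?ler1n //; lra.
Qed.


Lemma bin_leq_expn (m l : nat) : ('C(m, l) <= m ^ l)%N.
Proof.
apply: leq_trans (_ : m ^_ l <= _)%N; first by rewrite -bin_ffact leq_pmulr // fact_gt0.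
elim: l => [|l IH] //; rewrite ffactnSr expnSr leq_mul // leq_subr //.
Qed.

(** With s^(80k) = n and [B] of order n/s^40, the ratio of N to 'C(B, k) is O(s^(40k)), the square
    root of n. Both terms of the numerator are then O(n s^-38), and the factor [r0] costs one power
    of s. *)
Lemma unsat_literals_bound (s D : R) (r0 B : nat) : (2 <= q)%N -> (2 <= k)%N -> 1 <= s ->
  s ^+ (80 * k) = n%:R -> (0 < n)%N -> (k <= B)%N -> (2 * r0 <= n)%N ->
  n%:R <= B%:R * s ^+ 40 -> B%:R * s ^+ 40 <= 2 * n%:R ->
  r0%:R <= 161 * k%:R * s -> 0 <= D -> D * n%:R <= 3 * N%:R * (80 * k%:R * s) ->
  r0%:R * ((B%:R + n%:R / 'C(B, k)%:R * (r0%:R * D)) / ((n - r0) * q)%:R) <=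
  161 * k%:R * (2 + 3 * ((k * q) ^ k)%:R * (161 * k%:R) * (80 * k%:R)) * s^-1 ^+ 37.
Proof.
move=> q2 k2 s1 sn n0 kB r0n nB Bn r0s D0 Dn.
set K := k%:R in r0s Dn *; set c := ((k * q) ^ k)%:R.
have K0 : 0 <= K by exact: ler0n.
have [h hE] : exists h, h = (40 * k)%N by exists (40 * k)%N.
have [M ME] : exists M, M = (80 * k)%N by exists (80 * k)%N.
have [e1 e2 e3 e4] : [/\ M - 40 <= M - 38, h + 2 <= M - 38, 40 <= M & 38 <= M]%N by split; lia.
rewrite -ME in sn.
have c0 : 0 <= c by exact: ler0n.
have s0 : 0 < s by apply: lt_le_trans s1.
have nR : 0 < n%:R :> R by rewrite ltr0n.
have bB : 0 < 'C(B, k)%:R :> R by rewrite ltr0n bin_gt0.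
have r0R : 0 <= r0%:R :> R by exact: ler0n.
have ratio : N%:R <= c * s ^+ h * 'C(B, k)%:R.
  have h1 : B%:R ^+ k <= 'C(B, k)%:R * k%:R ^+ k :> R.
    by rewrite -!natrX -natrM ler_nat; have := bin_expn_le k kB; rewrite binn mul1n.
  have h2 : n%:R ^+ k <= B%:R ^+ k * s ^+ h.
    by rewrite hE exprM -exprMn; apply: lerXn2r; rewrite ?nnegrE ?mulr_ge0 ?exprn_ge0 // ltW.
  have h3 : N%:R <= q%:R ^+ k * n%:R ^+ k :> R.
    by rewrite natrM natrX ler_wpM2l ?exprn_ge0 // -natrX ler_nat bin_leq_expn.
  apply: le_trans h3 _; rewrite /c natrX natrM exprMn.
  have -> : k%:R ^+ k * q%:R ^+ k * s ^+ h * 'C(B, k)%:R =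
     q%:R ^+ k * ('C(B, k)%:R * k%:R ^+ k * s ^+ h) :> R by ring.
  rewrite ler_wpM2l ?exprn_ge0 //; apply: le_trans h2 _.
  by rewrite ler_wpM2r // exprn_ge0 // ltW.
have inner : n%:R / 'C(B, k)%:R * (r0%:R * D) <=
    3 * c * (161 * K) * (80 * K) * s ^+ (h + 2).
  have -> : n%:R / 'C(B, k)%:R * (r0%:R * D) = r0%:R * (D * n%:R) / 'C(B, k)%:R by ring.
  rewrite ler_pdivrMr //.
  apply: le_trans (_ : (161 * K * s) * (3 * (c * s ^+ h * 'C(B, k)%:R) * (80 * K * s)) <= _).
    apply: ler_pM => //; first by rewrite mulr_ge0 // ltW.
    apply: le_trans Dn _; apply: ler_wpM2r.
      by apply: mulr_ge0 (ltW s0); apply: mulr_ge0.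
    by apply: ler_wpM2l.
  by rewrite exprD le_eqVlt; apply/orP; left; apply/eqP; ring.
have c10 : 0 <= 3 * c * (161 * K) * (80 * K) by rewrite !mulr_ge0.
set c1 := 3 * c * (161 * K) * (80 * K) in inner c10 *.
have Bs : B%:R <= 2 * s ^+ (M - 38).
  apply: le_trans (_ : 2 * s ^+ (M - 40) <= _); last first.
    by rewrite ler_wpM2l // ler_weXn2l.
  rewrite -(ler_pM2r (exprn_gt0 40 s0)); apply: le_trans Bn _.
  by rewrite -sn -mulrA -exprD subnK.
have num : B%:R + n%:R / 'C(B, k)%:R * (r0%:R * D) <= (2 + c1) * s ^+ (M - 38).
  rewrite mulrDl; apply: lerD => //; apply: le_trans inner _.
  by rewrite ler_wpM2l // ler_weXn2l.
have den : n%:R <= ((n - r0) * q)%:R :> R.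
  rewrite ler_nat; apply: leq_trans (leq_mul (leqnn (n - r0)) q2).
  by move: r0n; clear; lia.
have denp : 0 < ((n - r0) * q)%:R :> R by apply: lt_le_trans den.
have delta : (B%:R + n%:R / 'C(B, k)%:R * (r0%:R * D)) / ((n - r0) * q)%:R <= (2 + c1) * s^-1 ^+ 38.
  rewrite ler_pdivrMr //; apply: le_trans num _.
  have x38 : 0 <= (2 + c1) * s^-1 ^+ 38 by rewrite mulr_ge0 ?exprn_ge0 ?invr_ge0 ?(ltW s0) //; lra.
  apply: le_trans (ler_wpM2l x38 den); rewrite -mulrA ler_wpM2l //; first lra.
  rewrite -sn -[M in X in _ <= X](subnK e4).
  by rewrite addnC exprD mulrA -exprMn mulVf ?gt_eqF // expr1n mul1r.
apply: le_trans (ler_wpM2l r0R delta) _.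
apply: le_trans (_ : 161 * K * s * ((2 + c1) * s^-1 ^+ 38) <= _).
  by apply: ler_wpM2r => //; rewrite mulr_ge0 ?exprn_ge0 ?invr_ge0 ?(ltW s0) //; lra.
rewrite exprS le_eqVlt; apply/orP; left; apply/eqP.
have -> : 161 * K * s * ((2 + c1) * (s^-1 * s^-1 ^+ 37)) = 161 * K * (2 + c1) * s^-1 ^+ 37 * (s / s) by ring.
by rewrite divff ?gt_eqF // mulr1.
Qed.

End Window.

(** * Choice of the parameters and conclusion *)

Section Main.
Variables (R : realType) (n q k : nat).
Local Notation C := (constraint n q k).
Local Notation L := ('I_n * 'I_q)%type.
Local Notation Ex p := (expect p [set: C]).
Local Notation unsat := (@unsat n q k R).
Local Notation N := ((q ^ k * 'C(n, k))%N).

(* The quantities entering the error term of [unsat_variance_le], as powers of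
   [x = 1/s] where [s ^ (80 k) = n]. *)
Lemma error_term_le (s c2 c4 C2 u e kappa Q w : R) (M : nat) :
  1 <= s -> (40 <= M)%N -> 0 <= c2 -> 0 <= c4 -> 0 <= C2 -> 0 <= u ->
  0 <= e -> e <= s^-1 ^+ M -> 0 <= kappa -> kappa <= c2 * s^-1 ^+ 37 ->
  0 <= Q -> Q <= c4 * s -> 0 <= w -> w <= C2 ->
  s^-1 ^+ 4 * Q + (s^-1 ^+ 4) ^- 3 *
    ((e + 2 * kappa) * Q + 2 * kappa * w + Q / s ^+ M + u / s ^+ M) <=
  (c4 + (1 + 2 * c2) * c4 + 2 * c2 * C2 + c4 + u) * s^-1 ^+ 2.
Proof.
move=> s1 M40 c20 c40 C20 u0 e0 eM kappa0 kappaM Q0 QM w0 wM.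
set x := s^-1 in eM kappaM *.
have s0 : 0 < s by apply: lt_le_trans s1.
have x0 : 0 < x by rewrite invr_gt0.
have x1 : x <= 1 by rewrite invf_le1.
have sx : s * x = 1 by rewrite divff // gt_eqF.
have xn m : 0 <= x ^+ m by rewrite exprn_ge0 // ltW.
have xle m : (2 <= m)%N -> x ^+ m <= x ^+ 2 by move=> h; apply: ler_wiXn2l => //; exact: ltW.
have red (a b m : nat) : (a + m = b)%N -> s ^+ a * x ^+ b = x ^+ m.
  by move=> <-; rewrite exprD mulrA -exprMn sx expr1n mul1r.
(* The loss s^12, and the s from [Q], are covered by the gain x^37. Every term keeps at least x^2,
   which leaves room for a later factor s. *)
have -> : (x ^+ 4) ^- 3 = s ^+ 12.
  by rewrite /x -exprM exprVn invrK.
have sM : (s ^+ M)^-1 = x ^+ M by rewrite exprVn.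
rewrite sM.
have xM37 : x ^+ M <= x ^+ 37 by apply: ler_wiXn2l; rewrite ?(ltW x0) //; apply: leq_trans M40.
have s12 : 0 <= s ^+ 12 by rewrite exprn_ge0 // ltW.
have T1 : x ^+ 4 * Q <= c4 * x ^+ 2.
  apply: le_trans (_ : x ^+ 4 * (c4 * s) <= _); first by rewrite ler_wpM2l.
  have -> : x ^+ 4 * (c4 * s) = c4 * (s ^+ 1 * x ^+ 4) by ring.
  by rewrite (red 1%N 4%N 3%N) // ler_wpM2l // xle.
have eps : e + 2 * kappa <= (1 + 2 * c2) * x ^+ 37.
  have := le_trans eM xM37; lra.
have T2 : s ^+ 12 * ((e + 2 * kappa) * Q) <= (1 + 2 * c2) * c4 * x ^+ 2.
  apply: le_trans (_ : s ^+ 12 * ((1 + 2 * c2) * x ^+ 37 * (c4 * s)) <= _).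
    by apply: ler_wpM2l => //; apply: ler_pM => //; lra.
  have -> : s ^+ 12 * ((1 + 2 * c2) * x ^+ 37 * (c4 * s)) =
    (1 + 2 * c2) * c4 * (s ^+ 13 * x ^+ 37) by ring.
  rewrite (red 13%N 37%N 24%N) //; apply: ler_wpM2l; last exact: xle.
  by apply: mulr_ge0 => //; lra.
have T3 : s ^+ 12 * (2 * kappa * w) <= 2 * c2 * C2 * x ^+ 2.
  apply: le_trans (_ : s ^+ 12 * (2 * (c2 * x ^+ 37) * C2) <= _).
    by apply: ler_wpM2l => //; apply: ler_pM => //; lra.
  have -> : s ^+ 12 * (2 * (c2 * x ^+ 37) * C2) = 2 * c2 * C2 * (s ^+ 12 * x ^+ 37) by ring.
  rewrite (red 12%N 37%N 25%N) //; apply: ler_wpM2l; last exact: xle.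
  by rewrite !mulr_ge0.
have T4 : s ^+ 12 * (Q * x ^+ M) <= c4 * x ^+ 2.
  apply: le_trans (_ : s ^+ 12 * (c4 * s * x ^+ 37) <= _).
    by apply: ler_wpM2l => //; apply: ler_pM.
  have -> : s ^+ 12 * (c4 * s * x ^+ 37) = c4 * (s ^+ 13 * x ^+ 37) by ring.
  by rewrite (red 13%N 37%N 24%N) // ler_wpM2l // xle.
have T5 : s ^+ 12 * (u * x ^+ M) <= u * x ^+ 2.
  apply: le_trans (_ : s ^+ 12 * (u * x ^+ 37) <= _).
    by apply: ler_wpM2l => //; apply: ler_wpM2l.
  rewrite mulrCA (red 12%N 37%N 25%N) //; apply: ler_wpM2l => //; exact: xle.
lra.
Qed.

Lemma variance_lower_bound (eta mu0 : R) : 0 < eta -> eta < 1 / 2 ->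
  eta <= mu0 -> mu0 <= 1 - eta -> eta / 2 <= mu0 - mu0 ^+ 2.
Proof.
move=> eta0 eta1 h1 h2.
have : 0 <= (mu0 - eta) * (1 - eta - mu0) by apply: mulr_ge0; lra.
have : 0 <= eta * (1 / 2 - eta) by apply: mulr_ge0; lra.
lra.
Qed.

Lemma unsat_literals_const_ge0 (K c : R) : 0 <= K -> 0 <= c ->
  0 <= 161 * K * (2 + 3 * c * (161 * K) * (80 * K)).
Proof. by move=> K0 c0; rewrite ?(mulr_ge0, addr_ge0, ler0n, K0, c0). Qed.

Lemma trunc_log2_le : (0 < n)%N -> (trunc_log 2 n).+1%:R <= 1 + 2 * ln n%:R :> R.
Proof.
move=> n0; have ln2 : 1 / 2 <= ln (2 : R).
  have h : (1 / 2 : R) <= - ln (1 / 2 : R).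
    have := @le_ln1Dx R (- (1 / 2)); rewrite (_ : 1 + - (1 / 2) = 1 / 2 :> R); last lra.
    by move=> /(_ ltac:(lra)); lra.
  have e2 : (2 : R) = (1 / 2)^-1 by rewrite div1r invrK.
  by rewrite [in leRHS]e2 lnV // posrE; lra.
have : 2 ^+ trunc_log 2 n <= n%:R :> R by rewrite -natrX ler_nat trunc_logP.
rewrite -ler_ln ?posrE ?exprn_gt0 ?ltr0n // lnXn // -[leLHS]mulr_natl => h.
have : (trunc_log 2 n)%:R * (1 / 2) <= ln n%:R :> R.
  by apply: le_trans h; apply: ler_wpM2l.
have -> : (trunc_log 2 n).+1%:R = (trunc_log 2 n)%:R + 1 :> R by rewrite natr1.
lra.
Qed.

Lemma density_le_half (C2 : R) : (2 <= q)%N -> (2 <= k)%N -> (k <= n)%N -> 0 < C2 ->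
  2 * C2 * k%:R ^+ k <= n%:R -> C2 * n%:R / N%:R <= 1 / 2.
Proof.
move=> q2 k2 kn C20 hn.
have nR : 0 < n%:R :> R by rewrite ltr0n (leq_trans _ kn) // ltnW.
have N0 : 0 < N%:R :> R by rewrite ltr0n muln_gt0 expn_gt0 bin_gt0 kn ltnW.
rewrite ler_pdivrMr //.
have h : n%:R ^+ k <= 'C(n, k)%:R * k%:R ^+ k :> R.
  by rewrite -!natrX -natrM ler_nat; have := bin_expn_le k kn; rewrite binn mul1n.
have h2 : n%:R * n%:R <= n%:R ^+ k :> R.
  by rewrite -expr2; apply: ler_weXn2l => //; rewrite ler1n -(ltr0n R).
have kk : 0 < k%:R ^+ k :> R by rewrite exprn_gt0 // ltr0n ltnW.
have h3 : 'C(n, k)%:R <= N%:R :> R by rewrite ler_nat leq_pmull // expn_gt0 ltnW.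
rewrite -(ler_pM2r kk).
have h4 : 2 * C2 * k%:R ^+ k * n%:R <= n%:R * n%:R by rewrite ler_wpM2r // ltW.
have h5 : 'C(n, k)%:R * k%:R ^+ k <= N%:R * k%:R ^+ k :> R by rewrite ler_wpM2r // ltW.
move: h h2 h4 h5; clear - R n q k; lra.
Qed.

(** By contradiction: a wide window provides a density where p D <= 3 C2 ln n / Cst while the
    variance is at least eta/2. The two terms of the variance bound are at most eta/8 each, the
    first because [d] is of order ln n, the second by the savings in powers of s. *)
Lemma window_le (eta r s Cst Kd : R) (d : nat) :
  let C2 := (q ^ k)%:R * (ln q%:R - ln eta) in
  let t := 3 * r ^+ 4 in
  let c2 := 161 * k%:R * (2 + 3 * ((k * q) ^ k)%:R * (161 * k%:R) * (80 * k%:R)) in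
  let c4 := 240 * k%:R * C2 in
  let c3 := c4 + (1 + 2 * c2) * c4 + 2 * c2 * C2 + c4 + (32 * t)^-1 in
  (2 <= q)%N -> (2 <= k)%N -> 0 < eta -> eta < 1 / 2 ->
  0 < r -> r <= 1 / 2 -> 64 * t <= 1 -> 64 * t * C2 <= (4 * expR 1 ^+ 2)^-1 ->
  1 <= Cst -> 1 <= s -> s ^+ (80 * k) = n%:R ->
  2 * C2 * k%:R ^+ k <= s -> 400 * k%:R <= s ->
  (0 < d)%N -> (r / 2) ^- d <= s -> ln n%:R <= Kd * d%:R -> 0 <= Kd ->
  3 * C2 * Kd / Cst <= eta / 8 -> c3 / s <= eta / 8 ->
  window n q k eta <= Cst * (n%:R / ln n%:R).
Proof.
move=> C2 t c2 c4 c3 q2 k2 eta0 eta1 r0' r2 t64 tC2 Cst1 s1 sn sC2 s400 d0 rd lnKd Kd0 CK c3s.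
have s0 : 0 < s by apply: lt_le_trans s1.
have kR : 2 <= k%:R :> R by rewrite ler_nat.
have s800 : 800 <= s by apply: le_trans s400; lra.
have [M ME] : exists M, M = (80 * k)%N by exists (80 * k)%N.
have [M160 M41 Mk] : [/\ 160 <= M, 41 <= M & k <= M]%N.
  by move: k2 ME; clear; move=> *; split; lia.
rewrite -ME in sn.
have s_le_n m : (m <= M)%N -> s ^+ m <= n%:R.
  by move=> mM; rewrite -sn; apply: ler_weXn2l.
have sn1 : s <= n%:R by rewrite -[s]expr1; apply: s_le_n; exact: leq_trans M41.
have nR : 0 < n%:R :> R by apply: lt_le_trans sn1.
have n0 : (0 < n)%N by rewrite -(ltr0n R).
have q0 : 0 < q%:R :> R by rewrite ltr0n ltnW.
have kn : (k <= n)%N by rewrite -(ler_nat R); move: s400 sn1 kR; clear - R n q k; lra.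
have lnq : 0 <= ln q%:R :> R by rewrite ln_ge0 // ler1n ltnW.
have lne : ln eta < 0 by rewrite ln_lt0 // eta0 /=; move: eta1; clear - R n q k; lra.
have qk0 : 0 < (q ^ k)%:R :> R by rewrite ltr0n expn_gt0 ltnW.
have C20 : 0 < C2 by apply: mulr_gt0 => //; move: lnq lne; clear - R n q k; lra.
have bnk : 0 < 'C(n, k)%:R :> R by rewrite ltr0n bin_gt0.
have N0 : 0 < N%:R :> R by rewrite natrM mulr_gt0.
have lnn0 : 0 < ln n%:R :> R by apply: ln_gt0; move: s800 sn1; clear - R n q k; lra.
have lnn : ln n%:R <= 80 * k%:R * s.
  have MR : M%:R = 80 * k%:R :> R by rewrite ME natrM.
  rewrite -sn lnXn // -[leLHS]mulr_natl MR; apply: ler_wpM2l; first by move: kR; clear - R n q k; lra.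
  exact: ltW (ln_sublinear s0).
have c20 : 0 <= c2 by exact: unsat_literals_const_ge0 (ler0n R k) (ler0n R ((k * q) ^ k)).
have c40 : 0 <= c4 by apply: mulr_ge0 (ltW C20); apply: mulr_ge0; exact: ler0n.
have t_gt0 : 0 < t by rewrite /t mulr_gt0 // exprn_gt0.
have [//|ltW'] := lerP (window n q k eta) (Cst * (n%:R / ln n%:R)).
exfalso.
set a := threshold n q k eta; set b := threshold n q k (1 - eta).
have WE : window n q k eta = N%:R * (b - a) by rewrite /window NconstraintsE.
pose pm := C2 * n%:R / N%:R.
have pm2 : pm <= 1 / 2 by exact: density_le_half C20 (le_trans sC2 sn1).
have bpm : b <= pm.
  apply: threshold_upper => //; first by move: eta1; clear - R n q k; lra.
  by rewrite -/C2 -/pm; move: pm2; clear - R n q k; lra.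
have a0 : 0 <= a by apply: threshold_ge0 => //; move: eta1; clear - R n q k; lra.
have ab : a < b.
  rewrite -subr_gt0 -(pmulr_rgt0 _ N0) -WE; apply: lt_trans ltW'.
  by apply: mulr_gt0; [exact: lt_le_trans Cst1 | exact: divr_gt0].
have b1 : b <= 1 by move: bpm pm2; clear - R n q k; lra.
pose D := 3 / (b - a).
have ba0 : 0 < b - a by rewrite subr_gt0.
have D0 : 0 < D by rewrite /D divr_gt0.
have DW : D * Cst * n%:R <= 3 * N%:R * ln n%:R.
  have -> : D * Cst * n%:R = 3 * (Cst * n%:R) / (b - a) by rewrite /D; ring.
  rewrite ler_pdivrMr // -!mulrA; apply: ler_wpM2l => //.
  have : Cst * n%:R / ln n%:R < N%:R * (b - a) by rewrite -mulrA -WE.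
  by rewrite ltr_pdivrMr // => /ltW h; apply: le_trans h _; clear - R n q k; lra.
have theta0 : 0 <= 64 * t by rewrite mulr_ge0 // ltW.
have b0 : 0 < b by apply: le_lt_trans ab.
have bN : b * N%:R <= C2 * n%:R by rewrite -ler_pdivlMr.
have dense_b : \sum_(J : {set C} | dense J) (64 * t * b) ^+ #|J| <= n%:R^-1.
  by apply: dense_sum_le bN _ tC2 => //; [exact: ltW | rewrite mulr_gt0].
(* The successor ensures n < 2^r0, so that (1/2)^r0 is below s^-M. *)
pose r0 := (trunc_log 2 n).+1.
have n_r0 : (n < 2 ^ r0)%N by apply: trunc_log_ltn.
have r0s : r0%:R <= 161 * k%:R * s.
  apply: le_trans (trunc_log2_le n0) _; move: lnn.
  have : 1 <= k%:R * s by apply: mulr_ege1 => //; move: kR; clear - R n q k; lra.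
  by clear - R n q k; lra.
(* Rounding up at most doubles n/s^40, which is at least 1. *)
pose B := (Num.truncn (n%:R / s ^+ 40)).+1.
have s40 : 0 < s ^+ 40 by rewrite exprn_gt0.
have nB : n%:R <= B%:R * s ^+ 40.
  rewrite -ler_pdivrMr //; apply/ltW; apply: real_truncnS_gt; exact: num_real.
have Bn : B%:R * s ^+ 40 <= 2 * n%:R.
  have -> : B%:R = (Num.truncn (n%:R / s ^+ 40))%:R + 1 :> R by rewrite natr1.
  rewrite -ler_pdivlMr //.
  have : (Num.truncn (n%:R / s ^+ 40))%:R <= n%:R / s ^+ 40.
    by rewrite truncn_le divr_ge0 // ltW.
  have : 1 <= n%:R / s ^+ 40 by rewrite ler_pdivlMr // mul1r s_le_n // ltnW.
  by rewrite -[2 * n%:R / _]mulrA; clear - R n q k; lra.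
have kB : (k <= B)%N.
  rewrite -(ler_nat R); have : s <= n%:R / s ^+ 40.
    by rewrite ler_pdivlMr // -exprS s_le_n.
  have : n%:R / s ^+ 40 <= B%:R by rewrite ler_pdivrMr.
  by move: s400 kR; clear - R n q k; lra.
have r0n : (2 * r0 <= n)%N.
  rewrite -(ler_nat R) natrM; have := s_le_n 2 (leq_trans (isT : (2 <= 41)%N) M41).
  have : 400 * k%:R * s <= s ^+ 2 by rewrite expr2 ler_wpM2r // ltW.
  have : 0 <= k%:R * s by rewrite mulr_ge0 // ltW.
  by move: r0s; clear - R n q k; lra.
(* One reference set of literals per size below [r0]; the empty set beyond is a default. *)
have /choice[sj sjP] : forall j : nat, exists s' : {set L},
    (j < r0)%N -> functional s' /\ #|s'| = j.
  move=> j; have [jr|jr] := ltnP j r0; last by exists set0.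
  have [|s' s'P] := @functional_family n q j (ltnW q2); last by exists s'.
  by move: jr r0n; clear; lia.
have r0_gt0 : (0 < r0)%N by [].
have [p [/andP[ap pb] H1 H2 H3]] :=
  select_density sj a0 ab b1 theta0 n0 r0_gt0 dense_b.
rewrite -/D in H1 H2 H3.
have p0 : 0 < p by apply: le_lt_trans ap.
have p2 : p <= 1 / 2 by move: pb bpm pm2; clear - R n q k; lra.
have p01 : 0 <= p <= 1 by rewrite (ltW p0) /=; move: p2; clear - R n q k; lra.
have DN : D * n%:R <= 3 * N%:R * (80 * k%:R * s).
  apply: le_trans (_ : 3 * N%:R * ln n%:R <= _); last first.
    by apply: ler_wpM2l => //; rewrite mulr_ge0 // ltW.
  apply: le_trans DW; rewrite -mulrA; apply: ler_wpM2l; first exact: ltW.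
  by rewrite ler_peMl // ltW.
have r0ltn : (r0 < n)%N by move: r0n n0; clear; lia.
have kap := unsat_literals_le p01 (ltnW q2) kB r0ltn sjP H3.
have kapn := unsat_literals_bound q2 k2 s1 (etrans (congr1 _ (esym ME)) sn) n0 kB r0n nB Bn r0s (ltW D0) DN.
rewrite -/c2 in kapn.
set kappa := r0%:R * _ in kapn.
have kappaP s' : functional s' -> (#|s'| <= r0)%N -> Ex p (unsat s') - Ex p (unsat set0) <= kappa.
  move=> fs cs; apply: le_trans (kap s' fs cs) _; apply: ler_wpM2r; last by rewrite ler_nat.
  apply: divr_ge0 => //; apply: addr_ge0 => //; apply: mulr_ge0; first exact: divr_ge0.
  by apply: mulr_ge0 => //; exact: ltW.
have kappa0 : 0 <= kappa.
  by have := kappaP _ (@functional0 n q); rewrite cards0 subrr; apply.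
have dense_p : \sum_(J : {set C} | dense J) (64 * t * p) ^+ #|J| <= n%:R^-1.
  apply: le_trans dense_b; apply: ler_sum => J _.
  apply: lerXn2r; rewrite ?nnegrE.
  - by apply: mulr_ge0 (ltW p0).
  - by apply: mulr_ge0 (ltW b0).
  - by apply: ler_wpM2l => //; exact: ltW.
have al0 : 0 < s^-1 ^+ 4 by rewrite exprn_gt0 // invr_gt0.
have := unsat_variance_le p0 p2 r0' r2 t64 n0 d0 al0 kappaP H1 H2 dense_p.
rewrite -/t card_constraint.
set mu0 := Ex p (unsat set0).
have mu_ge : eta <= mu0.
  apply: (gt_threshold kn _ _ ap); last by case/andP: p01.
  by move: eta1; clear - R n q k; lra.
have mu_lt : mu0 < 1 - eta by exact: lt_threshold p01 pb.
have var_ge := variance_lower_bound eta0 eta1 mu_ge (ltW mu_lt).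
have pmN : p * N%:R <= C2 * n%:R.
  apply: le_trans bN; apply: ler_wpM2r; [exact: ltW N0 | exact: ltW pb].
have Qb : p * D * Cst <= 3 * C2 * ln n%:R.
  rewrite -(ler_pM2r nR).
  apply: le_trans (_ : p * (3 * N%:R * ln n%:R) <= _).
    have -> : p * D * Cst * n%:R = p * (D * Cst * n%:R) by ring.
    by apply: ler_wpM2l => //; exact: ltW.
  have -> : p * (3 * N%:R * ln n%:R) = 3 * (p * N%:R) * ln n%:R by ring.
  have -> : 3 * C2 * ln n%:R * n%:R = 3 * (C2 * n%:R) * ln n%:R by ring.
  by apply: ler_wpM2r; [exact: ltW | apply: ler_wpM2l].
have Q0 : 0 <= p * D by apply: mulr_ge0; exact: ltW.
have Q1 : p * D <= c4 * s.
  apply: le_trans (_ : p * D * Cst <= _); first by rewrite ler_peMr.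
  apply: le_trans Qb _.
  have -> : c4 * s = 3 * C2 * (80 * k%:R * s) by rewrite /c4; ring.
  by apply: ler_wpM2l => //; rewrite mulr_ge0 // ltW.
have e0 : 0 <= (1 / 2) ^+ r0 :> R by apply: exprn_ge0; clear - R n q k; lra.
have eM : (1 / 2) ^+ r0 <= s^-1 ^+ M.
  rewrite exprVn sn expr_div_n expr1n div1r lef_pV2 ?posrE ?exprn_gt0 //.
  by rewrite -natrX ler_nat ltnW.
have w0 : 0 <= p * N%:R / n%:R by rewrite divr_ge0 // mulr_ge0 // ltW.
have wC : p * N%:R / n%:R <= C2 by rewrite ler_pdivrMr.
have u0 : 0 <= (32 * t)^-1 by rewrite invr_ge0 mulr_ge0 // ltW.
have err := error_term_le s1 (ltnW M41) c20 c40 (ltW C20) u0 e0 eM kappa0 kapn Q0 Q1 w0 wC.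
rewrite sn -/c3 in err.
have first : d%:R^-1 * (p * D) <= eta / 8.
  apply: le_trans CK; have dR : 0 < d%:R :> R by rewrite ltr0n.
  have CstR : 0 < Cst by exact: lt_le_trans Cst1.
  rewrite mulrC ler_pdivrMr // mulrAC ler_pdivlMr //; apply: le_trans Qb _.
  have -> : 3 * C2 * Kd * d%:R = 3 * C2 * (Kd * d%:R) by ring.
  by apply: ler_wpM2l lnKd; apply: mulr_ge0; [exact: ler0n | exact: ltW].
have c30 : 0 <= c3.
  have c2' : 0 <= 1 + 2 * c2 by move: c20; clear - R n q k; lra.
  have m1 := mulr_ge0 c2' c40.
  have m2 : 0 <= 2 * c2 * C2 by apply: mulr_ge0 (ltW C20); exact: mulr_ge0.
  by apply: addr_ge0 => //; apply: addr_ge0 => //; apply: addr_ge0 => //; apply: addr_ge0.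
set T := s^-1 ^+ 4 * _ + _ in err *.
have second : (r / 2) ^- d * T <= eta / 8.
  have rd0 : 0 <= (r / 2) ^- d by rewrite invr_ge0 exprn_ge0 // divr_ge0 // ltW.
  apply: le_trans (ler_wpM2l rd0 err) _.
  apply: le_trans c3s; apply: le_trans (_ : s * (c3 * s^-1 ^+ 2) <= _).
    by apply: ler_wpM2r rd; rewrite mulr_ge0 // exprn_ge0 // invr_ge0 ltW.
  rewrite le_eqVlt; apply/orP; left; apply/eqP.
  by rewrite expr2; field; rewrite gt_eqF.
by move: first second var_ge eta0; clear - R n q k; lra.
Qed.

End Main.

(** For r <= 1/2 one has 192 r^4 <= 24 r, so it is enough to bound 24 r and 24 r C2. *)
Lemma noise_rate_exists (R : realType) (C2 e : R) : 0 < C2 -> 0 < e ->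
  exists r, [/\ 0 < r, r <= 1 / 2, 64 * (3 * r ^+ 4) <= 1 & 64 * (3 * r ^+ 4) * C2 <= e].
Proof.
move=> C20 e0; have x0 : 0 < e / (24 * C2) by rewrite divr_gt0 // mulr_gt0.
pose r := Num.min (1 / 24) (e / (24 * C2)).
have r0 : 0 < r by rewrite lt_min x0 andbT.
have r1 : r <= 1 / 24 by rewrite ge_min lexx.
have r2 : r <= e / (24 * C2) by rewrite ge_min lexx orbT.
have r3 : r ^+ 3 <= (1 / 2) ^+ 3 by apply: lerXn2r; rewrite ?nnegrE; lra.
have r4 : 64 * (3 * r ^+ 4) <= 24 * r.
  have : r * r ^+ 3 <= r * (1 / 2) ^+ 3 by rewrite ler_wpM2l // ltW.
  lra.
exists r; split=> //; [lra | lra |].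
apply: le_trans (_ : 24 * r * C2 <= _); first by rewrite ler_wpM2r // ltW.
by move: r2; rewrite ler_pdivlMr ?mulr_gt0 //; lra.
Qed.

(** Take for [d] the integer part of ln s / ln (2/r). It is at least 1, so d + 1 <= 2 d. *)
Lemma depth_exists (R : realType) (r s : R) : 0 < r -> r <= 1 / 2 -> 2 / r <= s ->
  exists d : nat, [/\ (0 < d)%N, (r / 2) ^- d <= s & ln s <= 2 * ln (2 / r) * d%:R].
Proof.
move=> r0 r1 rs; have y0 : 0 < 2 / r by rewrite divr_gt0.
have s0 : 0 < s by apply: lt_le_trans rs.
have l0 : 0 < ln (2 / r) by rewrite ln_gt0 // ltr_pdivlMr //; lra.
have ls : 1 <= ln s / ln (2 / r) by rewrite ler_pdivlMr // mul1r ler_ln ?posrE.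
have t0 : 0 <= ln s / ln (2 / r) by lra.
exists (Num.truncn (ln s / ln (2 / r))); have /andP[lo hi] := truncn_itv t0.
have d0 : (0 < Num.truncn (ln s / ln (2 / r)))%N by rewrite truncn_ge_nat.
move: d0 lo hi; set d := Num.truncn _ => d0 lo hi; split=> //.
  rewrite -exprVn invf_div -[leLHS]lnK ?posrE ?exprn_gt0 // -[leRHS]lnK ?posrE //.
  by rewrite ler_expR lnXn // -[leLHS]mulr_natl -ler_pdivlMr.
apply: le_trans (_ : d.+1%:R * ln (2 / r) <= _); first by rewrite -ler_pdivrMr // ltW.
rewrite mulrAC ler_wpM2r ?(ltW l0) //.
by rewrite -natrM ler_nat; move: d0; lia.
Qed.

Theorem theorem7p9 (R : realType) (q k : nat) (eta : R)
    (hq : (2 <= q)%N) (hk : (2 <= k)%N)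
    (heta0 : 0 < eta) (heta1 : eta < 1 / 2)
    (hgamma : 0 < gammaqk R q k) :
  exists C : R, exists n0 : nat, forall n : nat, (n0 <= n)%N ->
    window n q k eta <= C * (n%:R / ln n%:R).
Proof.
pose C2 : R := (q ^ k)%:R * (ln q%:R - ln eta).
have lnq : 0 <= ln q%:R :> R by rewrite ln_ge0 // ler1n ltnW.
have lne : ln eta < 0 by rewrite ln_lt0 // heta0 /=; lra.
have C20 : 0 < C2.
  by apply: mulr_gt0; [rewrite ltr0n expn_gt0 ltnW | lra].
have e0 : 0 < (4 * expR 1 ^+ 2)^-1 :> R.
  by rewrite invr_gt0 mulr_gt0 // exprn_gt0 // expR_gt0.
have [r [r0 r2 t64 tC2]] := noise_rate_exists C20 e0.
pose t := 3 * r ^+ 4.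
pose c2 : R := 161 * k%:R * (2 + 3 * ((k * q) ^ k)%:R * (161 * k%:R) * (80 * k%:R)).
pose c4 : R := 240 * k%:R * C2.
pose c3 : R := c4 + (1 + 2 * c2) * c4 + 2 * c2 * C2 + c4 + (32 * t)^-1.
have y0 : 0 < 2 / r by rewrite divr_gt0.
have l0 : 0 < ln (2 / r) by rewrite ln_gt0 // ltr_pdivlMr //; lra.
(* From ln n = 80 k ln s and the bound on ln s in [depth_exists]. [Cst] then makes the term of order
   1/d at most eta/8. *)
pose Kd := 80 * k%:R * (2 * ln (2 / r)).
have Kd0 : 0 <= Kd by apply: mulr_ge0; apply: mulr_ge0; rewrite ?ler0n // ltW.
pose Cst := 1 + 24 * C2 * Kd / eta.
have Cst1 : 1 <= Cst.
  rewrite lerDl; apply: divr_ge0 (ltW heta0); apply: mulr_ge0 => //.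
  by apply: mulr_ge0; [exact: ler0n | exact: ltW].
have CK : 3 * C2 * Kd / Cst <= eta / 8.
  rewrite ler_pdivrMr ?(lt_le_trans ltr01) // /Cst mulrDr mulr1.
  have -> : eta / 8 * (24 * C2 * Kd / eta) = 3 * C2 * Kd by field; rewrite gt_eqF.
  by rewrite lerDr divr_ge0 // ltW.
pose z := 2 * C2 * k%:R ^+ k.
have z0 : 0 <= z.
  by apply: mulr_ge0; [apply: mulr_ge0 (ltW C20); exact: ler0n | exact/exprn_ge0/ler0n].
have k0 : 0 <= 400 * k%:R :> R by apply: mulr_ge0; exact: ler0n.
(* The sum of all lower bounds required of s; for n above s0^M, the root s of n is at least [s0]. *)
pose s0 := 1 + z + 400 * k%:R + 2 / r + `|8 * c3 / eta|.
have a0 := normr_ge0 (8 * c3 / eta).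
pose M := (80 * k)%N.
have M0 : (0 < M)%N by rewrite muln_gt0 /= ltnW.
exists Cst, (Num.truncn (s0 ^+ M)).+1 => n hn.
pose s := n%:R `^ M%:R^-1 : R.
have MR : M%:R != 0 :> R by rewrite pnatr_eq0 -lt0n.
have sn : s ^+ M = n%:R.
  by rewrite -powR_mulrn ?powR_ge0 // -powRrM mulVf // powRr1.
have s0s : s0 <= s.
  have s00 : 0 <= s0 by rewrite /s0; lra.
  rewrite -(ler_pXn2r M0) ?nnegrE ?powR_ge0 // sn.
  have := real_truncnS_gt (num_real (s0 ^+ M)) => /ltW/le_trans; apply.
  by rewrite ler_nat.
have ys : 2 / r <= s by apply: le_trans s0s; rewrite /s0; lra.
have [d [d0 rd ld]] := depth_exists r0 r2 ys.
have s_gt0 : 0 < s by apply: lt_le_trans ys.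
apply: (@window_le R n q k eta r s Cst Kd d) => //.
- by apply: le_trans s0s; rewrite /s0; lra.
- by apply: le_trans s0s; rewrite -/C2 -/z /s0; lra.
- by apply: le_trans s0s; rewrite /s0; lra.
- rewrite -sn lnXn // -[leLHS]mulr_natl natrM /Kd -[leRHS]mulrA.
  by apply: ler_wpM2l => //; apply: mulr_ge0; exact: ler0n.
- rewrite -/C2 -/c2 -/c4 -/t -/c3 ler_pdivrMr // mulrAC ler_pdivlMr // mulrC.
  rewrite [leRHS]mulrC -ler_pdivrMr // (le_trans (ler_norm _)) //.
  by apply: le_trans s0s; rewrite /s0; lra.
Qed.
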